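(* For all $\varepsilon\in[0,1)$: $\mathsf{WWKL}^\Delta\equiv_W\varepsilon\text{-}\mathsf{WWKL}*\mathsf{C}_\mathbb{N}$.
   Context: A represented space is a pair $(X,\delta_X)$ with $\delta_X:\subseteq\mathbb{N}^\mathbb{N}\to X$ a partial surjection. A realizer of $f:\subseteq X\rightrightarrows Y$ is a partial $F$ with $\delta_Y F(p)\in f(\delta_X(p))$ for all $p\in\mathrm{dom}(f\circ\delta_X)$. $f\le_W g$ if there are computable partial $H,K:\subseteq\mathbb{N}^\mathbb{N}\to\mathbb{N}^\mathbb{N}$ such that $p\mapsto H\langle p,GK(p)\rangle$ realizes $f$ for every realizer $G$ of $g$; $\equiv_W$ is the induced equivalence. The compositional product $f*g$ is the Weihrauch degree which is the maximum with respect to $\le_W$ of all compositions $f_0\circ g_0$ with $f_0\le_W f$ and $g_0\le_W g$ (it exists). $\mathsf C_\mathbb N$: given a nonempty $A\subseteq\mathbb N$ via an enumeration of $\mathbb N\setminus A$, output some element of $A$. $\mathrm{Tr}$ is the set of binary trees $T\subseteq\{0,1\}^*$, represented by characteristic functions; $[T]$ its set of infinite paths; $\mu$ the uniform measure on $2^\mathbb N$. $\mathsf{WWKL}:\subseteq\mathrm{Tr}\rightrightarrows2^\mathbb N$, $T\mapsto[T]$, has domain $\{T:\mu([T])>0\}$; $\varepsilon\text{-}\mathsf{WWKL}$ is its restriction to $\{T:\mu([T])>\varepsilon\}$. Discrete jump: $\lim_\Delta$ maps $\langle p_0,p_1,\dots\rangle$ (with $\langle p_0,p_1,\dots\rangle\langle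 i,j\rangle=p_i(j)$) to $\lim_ip_i$, restricted to eventually constant sequences $(p_i)$. The discrete jump $f^\Delta$ of $f:\subseteq(X,\delta_X)\rightrightarrows(Y,\delta_Y)$ is the same multi-valued function with input representation $\delta_X\circ\lim_\Delta$. *)

(* Defs.v *)
From Stdlib Require Import Reals Lia Arith List PArith Cantor.
From Stdlib Require Import Classical ClassicalEpsilon FunctionalExtensionality
  PropExtensionality ProofIrrelevance.
Import ListNotations.
Set Implicit Arguments.

Definition Baire := nat -> nat.

Definition npair (a b : nat) : nat := Cantor.to_nat (a, b).

Fixpoint code_list (l : list nat) : nat :=
  match l with
  | [] => 0
  | x :: l' => S (npair x (code_list l'))
  end.

Definition prefix (p : Baire) (k : nat) : list nat := map p (seq 0 k).

Definition bpair (p q : Baire) : Baire :=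
  fun n => if Nat.even n then p (Nat.div2 n) else q (Nat.div2 n).

Inductive prog : Type :=
| PZero : prog
| PSucc : prog
| PProj : nat -> prog
| PComp : prog -> list prog -> prog
| PRec  : prog -> prog -> prog
| PMu   : prog -> prog.

Inductive eval : prog -> list nat -> nat -> Prop :=
| eZero xs : eval PZero xs 0
| eSucc x xs : eval PSucc (x :: xs) (S x)
| eProj i xs : i < length xs -> eval (PProj i) xs (nth i xs 0)
| eComp f gs xs ys y : evals gs xs ys -> eval f ys y -> eval (PComp f gs) xs y
| eRec0 f g xs y : eval f xs y -> eval (PRec f g) (0 :: xs) y
| eRecS f g n xs z y :
    eval (PRec f g) (n :: xs) z -> eval g (n :: z :: xs) y ->
    eval (PRec f g) (S n :: xs) y
| eMu f xs y :
    eval f (y :: xs) 0 ->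
    (forall z, z < y -> exists v, v <> 0 /\ eval f (z :: xs) v) ->
    eval (PMu f) xs y
with evals : list prog -> list nat -> list nat -> Prop :=
| esNil xs : evals [] xs []
| esCons g gs xs y ys : eval g xs y -> evals gs xs ys -> evals (g :: gs) xs (y :: ys).

Definition recursive (h : nat -> nat) : Prop :=
  exists P : prog, forall n, eval P [n] (h n).

(* Computable partial functions on Baire space (via Kleene associates) *)
Definition computable (F : Baire -> option Baire) : Prop :=
  exists h, recursive h /\
    forall p q, F p = Some q -> forall n, exists k,
      h (npair n (code_list (prefix p k))) = S (q n) /\
      forall k', k' < k -> h (npair n (code_list (prefix p k'))) = 0.

(* names p x  <->  delta(p) = x ; delta is a partial surjection *)
Record RepSpace := {
  carrier :> Type;
  names : Baire -> carrier -> Prop;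
  names_fun : forall p x y, names p x -> names p y -> x = y;
  names_surj : forall x, exists p, names p x
}.

(* a partial multi-valued function f :⊆ X ⇉ Y, given by its graph;
   dom f = { x | exists y, prel x y } *)
Record Problem := {
  pin : RepSpace;
  pout : RepSpace;
  prel : pin -> pout -> Prop
}.

Definition realizes (f : Problem) (F : Baire -> option Baire) : Prop :=
  forall p x, names (pin f) p x -> (exists y, prel f x y) ->
    exists q, F p = Some q /\ exists y, names (pout f) q y /\ prel f x y.

Definition wcompose (H K G : Baire -> option Baire) : Baire -> option Baire :=
  fun p => match K p with
           | Some r => match G r with
                       | Some s => H (bpair p s)
                       | None => None
                       end
           | None => None
           end.

Definition Wred (f g : Problem) : Prop :=
  exists H K, computable H /\ computable K /\
    forall G, realizes g G -> realizes f (wcompose H K G).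

Definition Wequiv (f g : Problem) : Prop := Wred f g /\ Wred g f.

(* composition of multi-valued functions:
   dom (f o g) = { x in dom g | g(x) ⊆ dom f } *)
Definition comp_rel (X Y Z : Type) (f : Y -> Z -> Prop) (g : X -> Y -> Prop)
  : X -> Z -> Prop :=
  fun x z => (exists y, g x y) /\ (forall y, g x y -> exists z', f y z') /\
             exists y, g x y /\ f y z.

Definition compose (X Y Z : RepSpace) (f : Y -> Z -> Prop) (g : X -> Y -> Prop)
  : Problem := {| pin := X; pout := Z; prel := comp_rel f g |}.

(* h is (in the Weihrauch degree of) the compositional product f * g :
   the maximum w.r.t. <=W of all f0 o g0 with f0 <=W f and g0 <=W g *)
Definition IsCompProd (h f g : Problem) : Prop :=
  (exists (X Y Z : RepSpace) (f0 : Y -> Z -> Prop) (g0 : X -> Y -> Prop),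
     Wred {| pin := Y; pout := Z; prel := f0 |} f /\
     Wred {| pin := X; pout := Y; prel := g0 |} g /\
     Wequiv h (@compose X Y Z f0 g0)) /\
  (forall (X Y Z : RepSpace) (f0 : Y -> Z -> Prop) (g0 : X -> Y -> Prop),
     Wred {| pin := Y; pout := Z; prel := f0 |} f ->
     Wred {| pin := X; pout := Y; prel := g0 |} g ->
     Wred (@compose X Y Z f0 g0) h).

(* r = <p_0,p_1,...> with r<i,j> = p_i(j); lim_Delta r = lim p_i for   *)
(* eventually constant (p_i).                                          *)
Definition limDelta_names (r q : Baire) : Prop :=
  exists N, forall i j, N <= i -> r (npair i j) = q j.

Lemma jump_fun (X : RepSpace) :
  forall r (x y : carrier X),
    (exists q, limDelta_names r q /\ names X q x) ->
    (exists q, limDelta_names r q /\ names X q y) -> x = y.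
Proof.
  intros r x y [q1 [[N1 H1] Hx]] [q2 [[N2 H2] Hy]].
  assert (q1 = q2).
  { apply functional_extensionality; intro j.
    rewrite <- (H1 (max N1 N2) j), <- (H2 (max N1 N2) j); lia. }
  subst; eapply names_fun; eauto.
Qed.

Lemma jump_surj (X : RepSpace) :
  forall x : carrier X, exists r, exists q, limDelta_names r q /\ names X q x.
Proof.
  intro x; destruct (names_surj X x) as [q Hq].
  exists (fun n => q (snd (Cantor.of_nat n))), q; split; auto.
  exists 0; intros i j _; unfold npair; rewrite Cantor.cancel_of_to; reflexivity.
Qed.

Definition jumpSpace (X : RepSpace) : RepSpace := {|
  carrier := carrier X;
  names := fun r x => exists q, limDelta_names r q /\ names X q x;
  names_fun := @jump_fun X;
  names_surj := @jump_surj X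
|}.

Definition jump (f : Problem) : Problem :=
  {| pin := jumpSpace (pin f); pout := pout f; prel := prel f |}.

Definition b2n (b : bool) : nat := if b then 1 else 0.

Lemma cantor_fun : forall p (x y : nat -> bool),
  (forall n, p n = b2n (x n)) -> (forall n, p n = b2n (y n)) -> x = y.
Proof.
  intros p x y Hx Hy; apply functional_extensionality; intro n.
  specialize (Hx n); specialize (Hy n); rewrite Hx in Hy.
  destruct (x n), (y n); simpl in *; congruence.
Qed.

Lemma cantor_surj : forall x : nat -> bool,
  exists p, forall n, p n = b2n (x n).
Proof. intro x; exists (fun n => b2n (x n)); reflexivity. Qed.

Definition CantorSpace : RepSpace := {|
  carrier := nat -> bool;
  names := fun p x => forall n, p n = b2n (x n);
  names_fun := cantor_fun;
  names_surj := cantor_surj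
|}.

Lemma nat_fun : forall (p : Baire) (x y : nat), p 0 = x -> p 0 = y -> x = y.
Proof. intros; subst; reflexivity. Qed.
Lemma nat_surj : forall x : nat, exists p : Baire, p 0 = x.
Proof. intro x; exists (fun _ => x); reflexivity. Qed.

Definition NatSpace : RepSpace := {|
  carrier := nat;
  names := fun p x => p 0 = x;
  names_fun := nat_fun;
  names_surj := nat_surj
|}.

Lemma setN_fun : forall (p : Baire) (A B : nat -> Prop),
  (forall n, A n <-> ~ exists i, p i = S n) ->
  (forall n, B n <-> ~ exists i, p i = S n) -> A = B.
Proof.
  intros p A B HA HB; apply functional_extensionality; intro n.
  apply propositional_extensionality; rewrite HA, HB; tauto.
Qed.

Lemma setN_surj : forall A : nat -> Prop,
  exists p : Baire, forall n, A n <-> ~ exists i, p i = S n.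
Proof.
  intro A.
  exists (fun i => if excluded_middle_informative (A i) then 0 else S i).
  intro n; split.
  - intros Hn [i Hi]; destruct (excluded_middle_informative (A i)); [discriminate|].
    injection Hi; intros; subst; contradiction.
  - intro H; apply NNPP; intro Hn; apply H; exists n.
    destruct (excluded_middle_informative (A n)); [contradiction|reflexivity].
Qed.

Definition SetNSpace : RepSpace := {|
  carrier := nat -> Prop;
  names := fun p A => forall n, A n <-> ~ exists i, p i = S n;
  names_fun := setN_fun;
  names_surj := setN_surj
|}.

Definition CN : Problem :=
  {| pin := SetNSpace; pout := NatSpace; prel := fun A n => A n |}.

(* words w in {0,1}* are coded by a bijection wcode : list bool -> nat *)
Fixpoint pos_of (w : list bool) : positive :=
  match w with
  | [] => xH
  | true :: w' => xI (pos_of w')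
  | false :: w' => xO (pos_of w')
  end.

Fixpoint list_of (p : positive) : list bool :=
  match p with
  | xH => []
  | xI p' => true :: list_of p'
  | xO p' => false :: list_of p'
  end.

Definition wcode (w : list bool) : nat := pred (Pos.to_nat (pos_of w)).
Definition wdecode (n : nat) : list bool := list_of (Pos.of_nat (S n)).

Lemma list_of_pos_of w : list_of (pos_of w) = w.
Proof. induction w as [|[|] w IH]; simpl; congruence. Qed.

Lemma wdecode_wcode w : wdecode (wcode w) = w.
Proof.
  unfold wdecode, wcode.
  destruct (Pos2Nat.is_succ (pos_of w)) as [n Hn]; rewrite Hn, Nat.pred_succ.
  rewrite <- Hn, Pos2Nat.id; apply list_of_pos_of.
Qed.

Definition is_tree (t : list bool -> bool) : Prop :=
  forall u v, t (u ++ v) = true -> t u = true.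

Definition Tree := { t : list bool -> bool | is_tree t }.

Definition tree_names (p : Baire) (T : Tree) : Prop :=
  forall w, p (wcode w) = b2n (proj1_sig T w).

Lemma tree_fun : forall p (T1 T2 : Tree),
  tree_names p T1 -> tree_names p T2 -> T1 = T2.
Proof.
  intros p [t1 H1] [t2 H2] E1 E2; unfold tree_names in *; simpl in *.
  assert (t1 = t2).
  { apply functional_extensionality; intro w.
    specialize (E1 w); specialize (E2 w); rewrite E1 in E2.
    destruct (t1 w), (t2 w); simpl in *; congruence. }
  subst; f_equal; apply proof_irrelevance.
Qed.

Lemma tree_surj : forall T : Tree, exists p, tree_names p T.
Proof.
  intro T; exists (fun n => b2n (proj1_sig T (wdecode n))).
  intro w; rewrite wdecode_wcode; reflexivity.
Qed.

Definition TrSpace : RepSpace := {|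
  carrier := Tree;
  names := tree_names;
  names_fun := tree_fun;
  names_surj := tree_surj
|}.

Definition bprefix (x : nat -> bool) (n : nat) : list bool := map x (seq 0 n).

Definition paths (T : Tree) (x : nat -> bool) : Prop :=
  forall n, proj1_sig T (bprefix x n) = true.

(* Uniform (Lebesgue) measure on 2^N, via outer measure:               *)
(* mu*(A) = inf { sum_i 2^{-|w_i|} : A ⊆ U_i [w_i] }.                   *)
(* measure_gt A e  <->  mu*(A) > e.  (For closed A, mu*(A) = mu(A).)   *)
(* A cover is a sequence of optional words (None = empty set).         *)
Open Scope R_scope.

Definition cyl_weight (c : option (list bool)) : R :=
  match c with
  | None => 0
  | Some w => (/ 2) ^ (length w)
  end.

Fixpoint cover_psum (c : nat -> option (list bool)) (N : nat) : R :=
  match N with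
  | O => 0
  | S N' => cover_psum c N' + cyl_weight (c N')
  end.

Definition in_cyl (w : list bool) (x : nat -> bool) : Prop := bprefix x (length w) = w.

Definition covers (c : nat -> option (list bool)) (A : (nat -> bool) -> Prop) : Prop :=
  forall x, A x -> exists i w, c i = Some w /\ in_cyl w x.

Definition measure_gt (A : (nat -> bool) -> Prop) (e : R) : Prop :=
  exists d, e < d /\
    forall c, covers c A -> exists N, d <= cover_psum c N.

Definition WWKL : Problem :=
  {| pin := TrSpace; pout := CantorSpace;
     prel := fun T x => measure_gt (paths T) 0 /\ paths T x |}.

Definition epsWWKL (e : R) : Problem :=
  {| pin := TrSpace; pout := CantorSpace;
     prel := fun T x => measure_gt (paths T) e /\ paths T x |}.

Close Scope R_scope.

(* Main.v *)
(* Both inequalities go through "guess, then work on a tree whose guess is final".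

   WWKL^Delta is below a composition: if (T_i) is eventually constant with limit T and
   mu[T] > 0, then some cone of T has relative density > e at all levels, because
   otherwise iterated refinement would give covers of [T] of arbitrarily small weight.
   "T_i = T_N for i >= N, and the cone above u has density >= a/(a+1) at every level"
   is co-c.e. in (N, u), so C_N finds such a pair; by compactness the tree above u then
   has measure >= a/(a+1) > e, and e-WWKL finds a path in it.

   Every composition is below WWKL^Delta: from the enumeration given to C_N, guess the
   least number n not enumerated so far; the guess is eventually constant.  Row i of the
   name is the tree of words 1^n 0 w, w in T, where T is the tree which e-WWKL would
   receive if C_N had answered n.  A path of the limit has the form 1^n 0 z and thus
   reveals the correct answer n together with a path z of T. *)

(* The real [e] may be uncomputable, so the algorithm only knows a fixed natural number [a] with
   [e < a/(a+1)]; comparing [a * 2^m] with [a+1] times the number of words at level [m] is then a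
   decidable integer test, and it never has to decide an inequality between reals. The row [N] is
   guessed together with the cone, because a density test on a row other than the limit says nothing
   about the limit.

   In the converse direction the postprocessing cannot compute the final guess [n] from the input,
   as it never knows that a guess is final. The path is the only other source of information, whence
   the stem [1^n 0]. The stem divides the measure by [2^(n+1)]; no positive threshold would tolerate
   this for all [n], but the threshold 0 of [WWKL] does. *)
Require Import Defs.
From Stdlib Require Import Reals Lra Lia Arith List PArith Cantor.
From Stdlib Require Import Classical ClassicalEpsilon FunctionalExtensionality
  IndefiniteDescription FinFun.
Import ListNotations.
Set Implicit Arguments.

(** * Recursive functions *)

(** Composition and primitive recursion pass through several arguments, so closure properties are
    proved at fixed arity and transferred to the unary [recursive] afterwards. *)
Definition recursive_on (k : nat) (f : list nat -> nat) : Prop :=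
  exists P, forall xs, length xs = k -> eval P xs (f xs).

Lemma recursive_on_ext k f g :
  recursive_on k f -> (forall xs, length xs = k -> f xs = g xs) -> recursive_on k g.
Proof.
  intros [P HP] H; exists P; intros xs Hx; rewrite <- H by easy; auto.
Qed.

Lemma recursive_on_nth k i : i < k -> recursive_on k (fun xs => nth i xs 0).
Proof. intro H; exists (PProj i); intros xs Hx; constructor; lia. Qed.

Lemma recursive_on_zero k : recursive_on k (fun _ => 0).
Proof. exists PZero; intros; constructor. Qed.

Lemma recursive_on_S k f : recursive_on k f -> recursive_on k (fun xs => S (f xs)).
Proof.
  intros [P HP]; exists (PComp PSucc [P]); intros xs Hx.
  eapply eComp; [repeat constructor; auto|constructor].
Qed.

Lemma recursive_on_comp1 k (f : nat -> nat) g :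
  recursive_on 1 (fun ys => f (nth 0 ys 0)) -> recursive_on k g ->
  recursive_on k (fun xs => f (g xs)).
Proof.
  intros [P HP] [Q HQ]; exists (PComp P [Q]); intros xs Hx.
  eapply eComp; [repeat constructor; auto|].
  apply (HP [g xs]); easy.
Qed.

Lemma recursive_on_comp2 k (f : nat -> nat -> nat) g h :
  recursive_on 2 (fun ys => f (nth 0 ys 0) (nth 1 ys 0)) ->
  recursive_on k g -> recursive_on k h ->
  recursive_on k (fun xs => f (g xs) (h xs)).
Proof.
  intros [P HP] [Q HQ] [R HR]; exists (PComp P [Q; R]); intros xs Hx.
  eapply eComp; [repeat constructor; auto|].
  apply (HP [g xs; h xs]); easy.
Qed.

Lemma evals_PProj_seq xs m j : j + m <= length xs ->
  evals (map PProj (seq j m)) xs (map (fun i => nth i xs 0) (seq j m)).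
Proof.
  revert j; induction m as [|m IH]; intros j H; simpl; constructor.
  - constructor; lia.
  - apply IH; lia.
Qed.

Lemma map_nth_seq (xs : list nat) :
  map (fun i => nth i xs 0) (seq 0 (length xs)) = xs.
Proof.
  apply nth_ext with (d := 0) (d' := 0).
  - now rewrite length_map, length_seq.
  - intros n Hn; rewrite length_map, length_seq in Hn.
    rewrite nth_indep with (d' := nth 0 xs 0)
      by now rewrite length_map, length_seq.
    rewrite (map_nth (fun i => nth i xs 0)), seq_nth by easy; easy.
Qed.

Definition primrec (a : nat) (s : nat -> nat -> nat) (n : nat) : nat :=
  nat_rect (fun _ => nat) a s n.

Lemma recursive_on_primrec k a s b :
  recursive_on k a -> recursive_on (S (S k)) s -> recursive_on k b ->
  recursive_on k (fun xs => primrec (a xs) (fun i z => s (i :: z :: xs)) (b xs)).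
Proof.
  intros [Pa Ha] [Ps Hs] [Pb Hb].
  (* [PRec] recurses on its first argument, so the bound is put in front and the parameters [xs] are
     passed on by projections. *)
  exists (PComp (PRec Pa Ps) (Pb :: map PProj (seq 0 k))); intros xs Hx.
  eapply eComp.
  - constructor; [auto|]. apply evals_PProj_seq; lia.
  - rewrite <- Hx, map_nth_seq.
    induction (b xs) as [|n IH]; simpl.
    + constructor; auto.
    + econstructor; [exact IH|]. apply Hs; simpl; lia.
Qed.

(** * Case distinction and the inverses of Cantor pairing *)

Definition ifz (a b c : nat) : nat := match a with 0 => b | S _ => c end.
Definition triangle (n : nat) : nat := primrec 0 (fun i z => S i + z) n.
(** The largest [t] with [triangle t <= n]. It grows by at most one when [n] does, so primitive
    recursion finds it; the truncated difference vanishes exactly if [triangle (S z) <= S i]. *)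
Definition triangle_root (n : nat) : nat :=
  primrec 0 (fun i z => ifz (triangle (S z) - S i) (S z) z) n.
Definition snd_nat (n : nat) : nat := n - triangle (triangle_root n).
Definition fst_nat (n : nat) : nat := triangle_root n - snd_nat n.

Lemma npair_triangle a b : npair a b = b + triangle (b + a).
Proof. reflexivity. Qed.

Lemma triangle_S n : triangle (S n) = S n + triangle n.
Proof. reflexivity. Qed.

Lemma triangle_mono m n : m <= n -> triangle m <= triangle n.
Proof. induction 1; [lia|]; rewrite triangle_S; lia. Qed.

Lemma triangle_root_spec n :
  triangle (triangle_root n) <= n < triangle (S (triangle_root n)).
Proof.
  induction n as [|n IH]; [cbn; lia|].
  unfold triangle_root; cbn [primrec nat_rect]; fold (triangle_root n).
  change (nat_rect _ _ _ n) with (triangle_root n).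
  set (t := triangle_root n) in *; unfold ifz.
  destruct (triangle (S t) - S n) eqn:E; [|lia].
  rewrite (triangle_S (S t)); lia.
Qed.

Lemma triangle_root_npair a b : triangle_root (npair a b) = b + a.
Proof.
  pose proof (triangle_root_spec (npair a b)) as H.
  rewrite npair_triangle in *; set (t := triangle_root _) in *.
  destruct (Nat.lt_trichotomy t (b + a)) as [E|[E|E]]; [|easy|].
  - pose proof (@triangle_mono (S t) (b + a)); lia.
  - pose proof (@triangle_mono (S (b + a)) t E) as E'; rewrite triangle_S in E'; lia.
Qed.

Lemma snd_npair a b : snd_nat (npair a b) = b.
Proof. unfold snd_nat; rewrite triangle_root_npair, npair_triangle; lia. Qed.

Lemma fst_npair a b : fst_nat (npair a b) = a.
Proof. unfold fst_nat; rewrite snd_npair, triangle_root_npair; lia. Qed.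

Lemma npair_eta n : npair (fst_nat n) (snd_nat n) = n.
Proof.
  rewrite <- (cancel_to_of n); destruct (of_nat n) as [a b].
  change (to_nat (a, b)) with (npair a b); now rewrite fst_npair, snd_npair.
Qed.

Lemma recursive_on_pred k f : recursive_on k f -> recursive_on k (fun xs => pred (f xs)).
Proof.
  apply recursive_on_comp1.
  eapply recursive_on_ext.
  - apply (@recursive_on_primrec 1 (fun _ => 0) (fun ys => nth 0 ys 0)
             (fun ys => nth 0 ys 0)).
    + apply recursive_on_zero.
    + apply recursive_on_nth; lia.
    + apply recursive_on_nth; lia.
  - intros xs _; simpl; destruct (nth 0 xs 0); reflexivity.
Qed.

Lemma recursive_on_add k f g : recursive_on k f -> recursive_on k g ->
  recursive_on k (fun xs => f xs + g xs).
Proof.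
  apply recursive_on_comp2; eapply recursive_on_ext.
  - apply (@recursive_on_primrec 2 (fun ys => nth 1 ys 0) (fun ys => S (nth 1 ys 0))
             (fun ys => nth 0 ys 0));
      repeat apply recursive_on_S; apply recursive_on_nth; lia.
  - intros xs _; simpl; induction (nth 0 xs 0); simpl; auto.
Qed.

Lemma recursive_on_sub k f g : recursive_on k f -> recursive_on k g ->
  recursive_on k (fun xs => f xs - g xs).
Proof.
  apply recursive_on_comp2; eapply recursive_on_ext.
  - apply (@recursive_on_primrec 2 (fun ys => nth 0 ys 0) (fun ys => pred (nth 1 ys 0))
             (fun ys => nth 1 ys 0));
      try apply recursive_on_pred; apply recursive_on_nth; lia.
  - intros xs _; simpl; induction (nth 1 xs 0); simpl; [lia|].
    unfold primrec in *; rewrite IHn; lia.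
Qed.

Lemma recursive_on_mul k f g : recursive_on k f -> recursive_on k g ->
  recursive_on k (fun xs => f xs * g xs).
Proof.
  apply recursive_on_comp2; eapply recursive_on_ext.
  - apply (@recursive_on_primrec 2 (fun ys => 0) (fun ys => nth 3 ys 0 + nth 1 ys 0)
             (fun ys => nth 0 ys 0)).
    + apply recursive_on_zero.
    + apply recursive_on_add; apply recursive_on_nth; lia.
    + apply recursive_on_nth; lia.
  - intros xs _; simpl; induction (nth 0 xs 0); simpl; auto.
Qed.

Lemma recursive_on_ifz k f g h : recursive_on k f -> recursive_on k g ->
  recursive_on k h -> recursive_on k (fun xs => ifz (f xs) (g xs) (h xs)).
Proof.
  intros Hf Hg Hh.
  apply recursive_on_ext with
    (fun xs => (1 - f xs) * g xs + (1 - (1 - f xs)) * h xs).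
  - repeat first [apply recursive_on_add | apply recursive_on_mul
                 | apply recursive_on_sub | assumption
                 | apply recursive_on_S | apply recursive_on_zero].
  - intros xs _; unfold ifz; destruct (f xs); simpl; lia.
Qed.

Lemma recursive_on_triangle k f :
  recursive_on k f -> recursive_on k (fun xs => triangle (f xs)).
Proof.
  apply recursive_on_comp1.
  apply (@recursive_on_primrec 1 (fun _ => 0) (fun ys => S (nth 0 ys 0) + nth 1 ys 0)
           (fun ys => nth 0 ys 0)).
  - apply recursive_on_zero.
  - apply recursive_on_add; [apply recursive_on_S|]; apply recursive_on_nth; lia.
  - apply recursive_on_nth; lia.
Qed.

Lemma recursive_on_triangle_root k f :
  recursive_on k f -> recursive_on k (fun xs => triangle_root (f xs)).
Proof.
  apply recursive_on_comp1.
  apply (@recursive_on_primrec 1 (fun _ => 0)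
    (fun ys => ifz (triangle (S (nth 1 ys 0)) - S (nth 0 ys 0)) (S (nth 1 ys 0)) (nth 1 ys 0))
    (fun ys => nth 0 ys 0)).
  - apply recursive_on_zero.
  - repeat first [apply recursive_on_ifz | apply recursive_on_sub
                 | apply recursive_on_triangle | apply recursive_on_S
                 | apply recursive_on_nth; lia].
  - apply recursive_on_nth; lia.
Qed.

Lemma recursive_of_on f : recursive_on 1 (fun xs => f (nth 0 xs 0)) -> recursive f.
Proof. intros [P HP]; exists P; intro n; apply (HP [n]); easy. Qed.

Lemma recursive_to_on f : recursive f -> recursive_on 1 (fun xs => f (nth 0 xs 0)).
Proof.
  intros [P HP]; exists P; intros [|n [|? ?]]; try discriminate; intros _; apply HP.
Qed.

Lemma recursive_ext f g : recursive f -> (forall x, f x = g x) -> recursive g.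
Proof. intros [P HP] H; exists P; intro n; rewrite <- H; auto. Qed.

Lemma recursive_comp f g : recursive f -> recursive g -> recursive (fun x => f (g x)).
Proof.
  intros Hf Hg; apply recursive_of_on.
  apply (@recursive_on_comp1 1 f (fun xs => g (nth 0 xs 0))); now apply recursive_to_on.
Qed.

Lemma recursive_id : recursive (fun x => x).
Proof. apply recursive_of_on, recursive_on_nth; lia. Qed.

Lemma recursive_const c : recursive (fun _ => c).
Proof.
  apply recursive_of_on; induction c; [apply recursive_on_zero|now apply recursive_on_S].
Qed.

Lemma recursive_S f : recursive f -> recursive (fun x => S (f x)).
Proof.
  intro; apply recursive_of_on, recursive_on_S; now apply recursive_to_on.
Qed.

Lemma recursive_pred f : recursive f -> recursive (fun x => pred (f x)).
Proof.
  intro; apply recursive_of_on, recursive_on_pred; now apply recursive_to_on.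
Qed.

Lemma recursive_add f g : recursive f -> recursive g -> recursive (fun x => f x + g x).
Proof.
  intros; apply recursive_of_on, recursive_on_add; now apply recursive_to_on.
Qed.

Lemma recursive_sub f g : recursive f -> recursive g -> recursive (fun x => f x - g x).
Proof.
  intros; apply recursive_of_on, recursive_on_sub; now apply recursive_to_on.
Qed.

Lemma recursive_mul f g : recursive f -> recursive g -> recursive (fun x => f x * g x).
Proof.
  intros; apply recursive_of_on, recursive_on_mul; now apply recursive_to_on.
Qed.

Lemma recursive_ifz f g h : recursive f -> recursive g -> recursive h ->
  recursive (fun x => ifz (f x) (g x) (h x)).
Proof.
  intros; apply recursive_of_on, recursive_on_ifz; now apply recursive_to_on.
Qed.

Lemma recursive_snd f : recursive f -> recursive (fun x => snd_nat (f x)).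
Proof.
  intros; apply (@recursive_comp snd_nat); [|easy].
  apply recursive_of_on; unfold snd_nat.
  apply recursive_on_sub; [|apply recursive_on_triangle, recursive_on_triangle_root];
    apply recursive_on_nth; lia.
Qed.

Lemma recursive_fst f : recursive f -> recursive (fun x => fst_nat (f x)).
Proof.
  intros; apply (@recursive_comp fst_nat); [|easy].
  unfold fst_nat; apply recursive_sub, recursive_snd, recursive_id.
  apply recursive_of_on, recursive_on_triangle_root, recursive_on_nth; lia.
Qed.

Lemma recursive_npair f g : recursive f -> recursive g ->
  recursive (fun x => npair (f x) (g x)).
Proof.
  intros Hf Hg; apply recursive_ext with (fun x => g x + triangle (g x + f x)).
  - apply recursive_add; [easy|].
    apply (@recursive_comp triangle); [|now apply recursive_add].
    apply recursive_of_on, recursive_on_triangle, recursive_on_nth; lia.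
  - reflexivity.
Qed.

Definition recursive2 (f : nat -> nat -> nat) : Prop :=
  recursive (fun n => f (fst_nat n) (snd_nat n)).

Definition recursive3 (f : nat -> nat -> nat -> nat) : Prop :=
  recursive (fun n => f (fst_nat n) (fst_nat (snd_nat n)) (snd_nat (snd_nat n))).

Lemma recursive_comp2 f g h : recursive2 f -> recursive g -> recursive h ->
  recursive (fun x => f (g x) (h x)).
Proof.
  intros Hf Hg Hh.
  eapply recursive_ext.
  - apply (recursive_comp Hf (recursive_npair Hg Hh)).
  - intro x; simpl; now rewrite fst_npair, snd_npair.
Qed.

Lemma recursive_comp3 f g h k : recursive3 f -> recursive g -> recursive h ->
  recursive k -> recursive (fun x => f (g x) (h x) (k x)).
Proof.
  intros Hf Hg Hh Hk.
  eapply recursive_ext.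
  - apply (recursive_comp Hf (recursive_npair Hg (recursive_npair Hh Hk))).
  - intro x; simpl; now rewrite !fst_npair, !snd_npair, fst_npair.
Qed.

Lemma recursive_primrec a s b : recursive a -> recursive3 s -> recursive b ->
  recursive (fun x => primrec (a x) (s x) (b x)).
Proof.
  intros Ha Hs Hb.
  apply recursive_to_on in Ha, Hb.
  apply recursive_of_on.
  apply (@recursive_on_primrec 1 _
          (fun ys => s (nth 2 ys 0) (nth 0 ys 0) (nth 1 ys 0))); try easy.
  apply recursive_on_ext with (fun ys => (fun n =>
    s (fst_nat n) (fst_nat (snd_nat n)) (snd_nat (snd_nat n)))
      (npair (nth 2 ys 0) (npair (nth 0 ys 0) (nth 1 ys 0)))).
  - apply (@recursive_on_comp1 3 (fun n =>
      s (fst_nat n) (fst_nat (snd_nat n)) (snd_nat (snd_nat n)))).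
    + now apply recursive_to_on in Hs.
    + assert (Hp : forall k f g, recursive_on k f -> recursive_on k g ->
        recursive_on k (fun xs => npair (f xs) (g xs))).
      { intros k f g Hf Hg.
        apply (@recursive_on_add k g (fun xs => triangle (g xs + f xs))); [easy|].
        now apply recursive_on_triangle, recursive_on_add. }
      repeat apply Hp; apply recursive_on_nth; lia.
  - intros ys _; now rewrite !fst_npair, !snd_npair, fst_npair.
Qed.

Ltac recursive_hook := fail.
Ltac recursive_step :=
  unfold recursive2, recursive3 in *; cbv beta;
  first [ assumption | simple apply recursive_const | simple apply recursive_id
        | simple apply recursive_fst | simple apply recursive_snd
        | simple apply recursive_S | simple apply recursive_pred
        | simple apply recursive_add | simple apply recursive_sub | simple apply recursive_mul
        | simple apply recursive_ifz | simple apply recursive_npair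
        | match goal with
          | H : recursive (fun n => ?f (fst_nat n) (snd_nat n)) |- recursive (fun x => ?f _ _) =>
              simple apply (fun g h => @recursive_comp2 f g h H)
          | H : recursive (fun n => ?f (fst_nat n) (fst_nat (snd_nat n)) (snd_nat (snd_nat n)))
              |- recursive (fun x => ?f _ _ _) =>
              simple apply (fun g h k => @recursive_comp3 f g h k H)
          | H : recursive ?f |- recursive (fun x => ?f _) => apply (recursive_comp H)
          end
        | recursive_hook ].
Ltac recursive_tac := repeat recursive_step.

Definition sum_below (f : nat -> nat) (n : nat) : nat := primrec 0 (fun i z => z + f i) n.

Lemma recursive_sum_below f b : recursive2 f -> recursive b ->
  recursive (fun x => sum_below (f x) (b x)).
Proof.
  intros Hf Hb; unfold sum_below.
  apply (@recursive_primrec (fun _ => 0) (fun x i z => z + f x i)); recursive_tac.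
Qed.

(** Least [s < k] with [g s = 0], and [k] if there is none. *)
Definition first_zero (g : nat -> nat) (k : nat) : nat :=
  primrec 0 (fun _ s => ifz (g s) s (S s)) k.

Lemma recursive_first_zero g b : recursive2 g -> recursive b ->
  recursive (fun x => first_zero (g x) (b x)).
Proof.
  intros Hg Hb; unfold first_zero.
  apply (@recursive_primrec (fun _ => 0) (fun x _ s => ifz (g x s) s (S s)));
    recursive_tac.
Qed.

Lemma first_zero_below g k i : i < first_zero g k -> g i <> 0.
Proof.
  induction k as [|k IH]; simpl; [lia|].
  change (first_zero g (S k)) with (ifz (g (first_zero g k)) (first_zero g k) (S (first_zero g k))).
  destruct (g (first_zero g k)) eqn:E; simpl; auto.
  intro H; destruct (Nat.eq_dec i (first_zero g k)) as [->|]; [lia|apply IH; lia].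
Qed.

Lemma first_zero_le g k : first_zero g k <= k.
Proof.
  induction k as [|k IH]; [cbn; lia|].
  change (first_zero g (S k)) with (ifz (g (first_zero g k)) (first_zero g k) (S (first_zero g k))).
  destruct (g (first_zero g k)); simpl; lia.
Qed.

Lemma first_zero_ge g k n : n <= k -> (forall i, i < n -> g i <> 0) -> n <= first_zero g k.
Proof.
  revert n; induction k as [|k IH]; intros n Hn H; [lia|].
  change (first_zero g (S k)) with (ifz (g (first_zero g k)) (first_zero g k) (S (first_zero g k))).
  destruct n as [|n]; [lia|].
  assert (n <= first_zero g k) by (apply IH; [lia|intros; apply H; lia]).
  destruct (g (first_zero g k)) eqn:E; simpl; [|lia].
  destruct (le_lt_dec (S n) (first_zero g k)); [lia|].
  exfalso; apply (H (first_zero g k)); lia.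
Qed.

Lemma first_zero_eq g k n : n <= k -> (forall i, i < n -> g i <> 0) -> g n = 0 ->
  first_zero g k = n.
Proof.
  intros Hk H H0; pose proof (first_zero_ge g Hk H).
  destruct (Nat.eq_dec (first_zero g k) n); [easy|].
  exfalso; apply (@first_zero_below g k n); [lia|easy].
Qed.

(** Used for stability: a longer oracle prefix decides more queries, so the first undecided one can
    only move up. *)
Lemma first_zero_mono g g' k k' : k <= k' ->
  (forall i, g i <> 0 -> g' i <> 0) -> first_zero g k <= first_zero g' k'.
Proof.
  intros H Hg; apply first_zero_ge.
  - pose proof (first_zero_le g k); lia.
  - intros i Hi; apply Hg, (@first_zero_below g k), Hi.
Qed.

(** * Codes of finite lists *)

Definition code_init (f : nat -> nat) (k : nat) : nat :=
  primrec 0 (fun i z => S (npair (f (k - S i)) z)) k.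

Lemma code_init_prefix f k : code_init f k = code_list (prefix f k).
Proof.
  unfold code_init, prefix.
  (* Consing starts at the end of the list, so after [m] rounds the code is that of the last [m]
     entries. *)
  assert (H : forall m, m <= k ->
    primrec 0 (fun i z => S (npair (f (k - S i)) z)) m = code_list (map f (seq (k - m) m))).
  { induction m as [|m IH]; intro Hm; [reflexivity|].
    simpl; unfold primrec in IH |- *; rewrite IH by lia.
    now replace (S (k - S m)) with (k - m) by lia. }
  rewrite H by lia; now rewrite Nat.sub_diag.
Qed.

Lemma recursive_code_init f b : recursive2 f -> recursive b ->
  recursive (fun x => code_init (f x) (b x)).
Proof.
  intros Hf Hb; unfold code_init.
  apply (@recursive_primrec (fun _ => 0)
    (fun x i z => S (npair (f x (b x - S i)) z))); recursive_tac.
Qed.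

(** Past the end of the list this stays at 0, the code of the empty list, because [pred] and
    [snd_nat] fix 0. *)
Definition code_drop (c i : nat) : nat := primrec c (fun _ z => snd_nat (pred z)) i.
Definition code_nth (c i : nat) : nat := fst_nat (pred (code_drop c i)).
(** The bound [c] suffices, as a list is never longer than its code. *)
Definition code_length (c : nat) : nat := first_zero (code_drop c) c.

Lemma recursive_code_drop f g : recursive f -> recursive g ->
  recursive (fun x => code_drop (f x) (g x)).
Proof.
  intros Hf Hg; unfold code_drop.
  apply (@recursive_primrec f (fun x _ z => snd_nat (pred z))); recursive_tac.
Qed.

Lemma recursive_code_nth f g : recursive f -> recursive g ->
  recursive (fun x => code_nth (f x) (g x)).
Proof.
  intros; unfold code_nth; apply recursive_fst, recursive_pred.
  now apply recursive_code_drop.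
Qed.

Lemma recursive_code_length f : recursive f -> recursive (fun x => code_length (f x)).
Proof.
  intros; unfold code_length.
  apply (@recursive_first_zero (fun x => code_drop (f x))); [|easy].
  apply recursive_code_drop; recursive_tac.
Qed.

Lemma code_drop_spec l i : code_drop (code_list l) i = code_list (skipn i l).
Proof.
  induction i as [|i IH]; [reflexivity|].
  change (code_drop (code_list l) (S i)) with (snd_nat (pred (code_drop (code_list l) i))).
  rewrite IH.
  replace (skipn (S i) l) with (skipn 1 (skipn i l)) by now rewrite skipn_skipn.
  destruct (skipn i l); [reflexivity|simpl; apply snd_npair].
Qed.

Lemma code_nth_spec l i : code_nth (code_list l) i = nth i l 0.
Proof.
  unfold code_nth; rewrite code_drop_spec.
  rewrite <- (firstn_skipn i l) at 2.
  destruct (le_lt_dec (length l) i) as [H|H].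
  - rewrite skipn_all2, firstn_all2 by easy; rewrite nth_overflow; [reflexivity|].
    rewrite app_nil_r; easy.
  - rewrite app_nth2; rewrite length_firstn; [|lia].
    replace (i - min i (length l)) with 0 by lia.
    destruct (skipn i l); [reflexivity|simpl; apply fst_npair].
Qed.

Lemma length_le_code_list l : length l <= code_list l.
Proof.
  induction l as [|x l IH]; simpl; [lia|].
  assert (code_list l <= npair x (code_list l)) by (rewrite npair_triangle; lia); lia.
Qed.

Lemma code_length_spec l : code_length (code_list l) = length l.
Proof.
  unfold code_length; apply first_zero_eq.
  - apply length_le_code_list.
  - intros i Hi; rewrite code_drop_spec.
    destruct (skipn i l) eqn:E; [|simpl; lia].
    apply (f_equal (@length nat)) in E; rewrite length_skipn in E; simpl in E; lia.
  - now rewrite code_drop_spec, skipn_all2.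
Qed.

Lemma recursive_div f g : recursive f -> recursive g -> (forall x, g x <> 0) ->
  recursive (fun x => f x / g x).
Proof.
  intros Hf Hg Hg0.
  apply recursive_ext with
    (fun x => primrec 0 (fun i z => ifz (g x * S z - S i) (S z) z) (f x)).
  - apply (@recursive_primrec (fun _ => 0) (fun x i z => ifz (g x * S z - S i) (S z) z));
      recursive_tac.
  - intro x; set (b := g x); assert (Hb : b <> 0) by apply Hg0.
    assert (H : forall n, let d := primrec 0 (fun i z => ifz (b * S z - S i) (S z) z) n in
      b * d <= n < b * S d).
    { induction n as [|n IH]; [cbn; lia|].
      cbn [primrec nat_rect]; unfold primrec in *; set (d := nat_rect _ _ _ n) in *.
      cbv zeta in *; unfold ifz; destruct (b * S d - S n) eqn:E; nia. }
    specialize (H (f x)); set (d := primrec _ _ _) in *; cbv zeta in H.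
    apply Nat.div_unique with (f x - b * d); nia.
Qed.

Lemma recursive_mod f g : recursive f -> recursive g -> (forall x, g x <> 0) ->
  recursive (fun x => f x mod g x).
Proof.
  intros Hf Hg Hg0.
  apply recursive_ext with (fun x => f x - g x * (f x / g x)).
  - pose proof (recursive_div Hf Hg Hg0) as Hd; recursive_tac.
  - intro x; pose proof (Nat.div_mod (f x) (g x) (Hg0 x)); lia.
Qed.

Lemma recursive_pow2 f : recursive f -> recursive (fun x => 2 ^ f x).
Proof.
  intros Hf; apply recursive_ext with (fun x => primrec 1 (fun _ z => z + z) (f x)).
  - apply (@recursive_primrec (fun _ => 1) (fun _ _ z => z + z)); recursive_tac.
  - intro x; induction (f x) as [|n IH]; [reflexivity|].
    unfold primrec in *; simpl in *; lia.
Qed.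

Lemma pow2_nonzero n : 2 ^ n <> 0.
Proof. now apply Nat.pow_nonzero. Qed.

Ltac recursive_hook ::=
  first [ simple apply recursive_pow2
        | simple apply recursive_div; [| | intro; first [apply pow2_nonzero | easy]]
        | simple apply recursive_mod; [| | intro; first [apply pow2_nonzero | easy]]
        | simple apply recursive_code_nth | simple apply recursive_code_length
        | simple apply recursive_code_drop
        | simple apply recursive_code_init | simple apply recursive_first_zero
        | simple apply recursive_sum_below ].

Lemma bpair_mod p q n : bpair p q n = ifz (n mod 2) (p (n / 2)) (q (n / 2)).
Proof.
  unfold bpair; rewrite Nat.div2_div.
  destruct (Nat.even n) eqn:E.
  - apply Nat.even_spec in E; destruct E as [k ->].
    now rewrite Nat.mul_comm, Nat.Div0.mod_mul.
  - assert (O : Nat.odd n = true) by (unfold Nat.odd; now rewrite E).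
    apply Nat.odd_spec in O; destruct O as [k ->].
    now rewrite Nat.mul_comm, Nat.add_comm, Nat.Div0.mod_add.
Qed.

Lemma bpair_even p q n : bpair p q (2 * n) = p n.
Proof.
  rewrite bpair_mod, (Nat.mul_comm 2 n), Nat.Div0.mod_mul, Nat.div_mul by easy; easy.
Qed.

Lemma bpair_odd p q n : bpair p q (2 * n + 1) = q n.
Proof.
  rewrite bpair_mod, (Nat.mul_comm 2 n), (Nat.add_comm (n * 2)), Nat.Div0.mod_add,
    Nat.div_add by easy; easy.
Qed.

(** * Computable functionals *)

Definition code_prefix (p : Baire) (k : nat) : nat := code_list (prefix p k).

Lemma prefix_ext p q k : (forall i, i < k -> p i = q i) -> prefix p k = prefix q k.
Proof.
  intro H; apply map_ext_in; intros i Hi; apply H; apply in_seq in Hi; lia.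
Qed.

Lemma code_length_prefix p k : code_length (code_prefix p k) = k.
Proof.
  unfold code_prefix, prefix; now rewrite code_length_spec, length_map, length_seq.
Qed.

Lemma code_nth_prefix p k i : i < k -> code_nth (code_prefix p k) i = p i.
Proof.
  intro H; unfold code_prefix, prefix; rewrite code_nth_spec.
  rewrite nth_indep with (d' := p 0) by now rewrite length_map, length_seq.
  now rewrite map_nth, seq_nth.
Qed.

Lemma code_init_nth_prefix p k i : i <= k ->
  code_init (code_nth (code_prefix p k)) i = code_prefix p i.
Proof.
  intro H; rewrite code_init_prefix; unfold code_prefix at 2; f_equal.
  apply prefix_ext; intros; apply code_nth_prefix; lia.
Qed.

(** [phi c x] is the output on input [x] after reading the oracle prefix coded
    by [c]: either [0] (undecided) or [S v]. *)
Definition stable (phi : nat -> nat -> nat) : Prop :=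
  forall p x k k', k <= k' -> phi (code_prefix p k) x <> 0 ->
    phi (code_prefix p k') x = phi (code_prefix p k) x.

Definition converges (phi : nat -> nat -> nat) (p : Baire) (x v : nat) : Prop :=
  exists k, phi (code_prefix p k) x = S v.

(** [Phi] lists the values that must be found and demands nothing elsewhere, which covers partial
    functionals. For an associate only the first answer counts, and this convention is awkward under
    composition; stable approximations compose well. [computable_rel_first_hit] and
    [computable_of_rel] translate between the two. *)
Definition computable_rel (Phi : Baire -> nat -> nat -> Prop) : Prop :=
  exists phi, recursive2 phi /\ stable phi /\
    forall p x v, Phi p x v -> converges phi p x v.

Definition computable_total (F : Baire -> nat -> nat) : Prop :=
  computable_rel (fun p x v => v = F p x).

Lemma stable_eq phi p x v k k' : stable phi ->
  phi (code_prefix p k) x = S v -> k <= k' -> phi (code_prefix p k') x = S v.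
Proof.
  intros Hs H Hk; rewrite <- H; apply Hs; [easy|]; rewrite H; easy.
Qed.

Lemma stable_unique phi p x v w k k' : stable phi ->
  phi (code_prefix p k) x = S v -> phi (code_prefix p k') x = S w -> v = w.
Proof.
  intros Hs Hv Hw; destruct (Nat.le_ge_cases k k') as [H|H].
  - apply (stable_eq p x Hs Hv) in H; congruence.
  - apply (stable_eq p x Hs Hw) in H; congruence.
Qed.

Lemma converges_below phi p (x : nat -> nat) q n : stable phi ->
  (forall i, i < n -> converges phi p (x i) (q i)) ->
  exists K, forall k i, K <= k -> i < n -> phi (code_prefix p k) (x i) = S (q i).
Proof.
  intro Hs; induction n as [|n IH]; intro H; [exists 0; intros; lia|].
  destruct IH as [K HK]; [intros; apply H; lia|].
  destruct (H n) as [K' HK']; [lia|].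
  exists (max K K'); intros k i Hk Hi.
  destruct (Nat.eq_dec i n) as [->|].
  - apply (stable_eq p _ Hs HK'); lia.
  - apply HK; lia.
Qed.

Lemma computable_rel_weaken (Phi Psi : Baire -> nat -> nat -> Prop) :
  computable_rel Phi -> (forall p x v, Psi p x v -> Phi p x v) -> computable_rel Psi.
Proof.
  intros (phi & H1 & H2 & H3) H; exists phi; repeat split; auto.
Qed.

Lemma computable_total_ext F G :
  computable_total F -> (forall p x, F p x = G p x) -> computable_total G.
Proof.
  intros HF H; apply (computable_rel_weaken _ HF); intros p x v ->; now rewrite H.
Qed.

Lemma computable_total_recursive f : recursive f -> computable_total (fun _ x => f x).
Proof.
  intro Hf; exists (fun _ x => S (f x)); split; [|split].
  - recursive_tac.
  - intros p x k k0 _ _; reflexivity.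
  - intros p x v ->; exists 0; reflexivity.
Qed.

Lemma computable_rel_query : computable_total (fun p x => p x).
Proof.
  exists (fun c x => ifz (code_length c - x) 0 (S (code_nth c x))); split; [|split].
  - recursive_tac.
  - intros p x k k' Hk; rewrite !code_length_prefix.
    unfold ifz; destruct (k - x) eqn:E; [easy|]; intros _.
    destruct (k' - x) eqn:E'; [lia|].
    rewrite !code_nth_prefix; lia.
  - intros p x v ->; exists (S x); rewrite code_length_prefix, code_nth_prefix by lia.
    now replace (S x - x) with 1 by lia.
Qed.

Lemma computable_rel_bind Phi Psi : computable_rel Phi -> computable_rel Psi ->
  computable_rel (fun p x w => exists v, Phi p x v /\ Psi p (npair x v) w).
Proof.
  intros (phi & R1 & S1 & C1) (psi & R2 & S2 & C2).
  exists (fun c x => ifz (phi c x) 0 (psi c (npair x (pred (phi c x))))); split; [|split].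
  - recursive_tac.
  - intros p x k k' Hk; destruct (phi (code_prefix p k) x) as [|v] eqn:E; [easy|].
    rewrite (stable_eq p x S1 E Hk); simpl; now apply S2.
  - intros p x w (v & Hv & Hw); apply C1 in Hv as [k Hk]; apply C2 in Hw as [k' Hk'].
    exists (max k k').
    rewrite (stable_eq p x S1 Hk) by lia; simpl.
    apply (stable_eq p _ S2 Hk'); lia.
Qed.

Lemma computable_rel_comp Phi Psi : computable_rel Phi -> computable_rel Psi ->
  computable_rel (fun p x w => exists v, Phi p x v /\ Psi p v w).
Proof.
  intros H1 (psi & R2 & S2 & C2).
  apply (@computable_rel_bind Phi (fun p y w => Psi p (snd_nat y) w)) in H1.
  - apply (computable_rel_weaken _ H1); intros p x w (v & Hv & Hw).
    exists v; now rewrite snd_npair.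
  - exists (fun c y => psi c (snd_nat y)); split; [|split].
    + recursive_tac.
    + intros p x; apply S2.
    + intros p x v H; now apply C2.
Qed.

Lemma computable_total_comp F G : computable_total F -> computable_total G ->
  computable_total (fun p x => F p (G p x)).
Proof.
  intros HF HG; apply (computable_rel_weaken _ (computable_rel_comp HG HF)).
  intros p x v ->; eauto.
Qed.

Lemma computable_total_query G :
  computable_total G -> computable_total (fun p x => p (G p x)).
Proof. apply (computable_total_comp computable_rel_query). Qed.

Lemma computable_total_comp1 f G : recursive f ->
  computable_total G -> computable_total (fun p x => f (G p x)).
Proof. intro Hf; apply (computable_total_comp (computable_total_recursive Hf)). Qed.

Lemma computable_total_npair F G : computable_total F -> computable_total G ->
  computable_total (fun p x => npair (F p x) (G p x)).
Proof.
  intros (phi & R1 & S1 & C1) (psi & R2 & S2 & C2).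
  exists (fun c x => ifz (phi c x) 0 (ifz (psi c x) 0
            (S (npair (pred (phi c x)) (pred (psi c x)))))); split; [|split].
  - recursive_tac.
  - intros p x k k' Hk; destruct (phi (code_prefix p k) x) as [|v] eqn:E; [easy|].
    destruct (psi (code_prefix p k) x) as [|w] eqn:E'; [easy|].
    now rewrite (stable_eq p x S1 E Hk), (stable_eq p x S2 E' Hk).
  - intros p x v ->.
    destruct (C1 p x _ eq_refl) as [k Hk]; destruct (C2 p x _ eq_refl) as [k' Hk'].
    exists (max k k').
    rewrite (stable_eq p x S1 Hk), (stable_eq p x S2 Hk') by lia; reflexivity.
Qed.

Lemma computable_total_comp2 f F G : recursive2 f ->
  computable_total F -> computable_total G ->
  computable_total (fun p x => f (F p x) (G p x)).
Proof.
  intros Hf HF HG.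
  apply (computable_total_ext _ (computable_total_comp1 Hf (computable_total_npair HF HG))).
  intros p x; simpl; now rewrite fst_npair, snd_npair.
Qed.

Lemma computable_total_ifz F G H : computable_total F -> computable_total G ->
  computable_total H -> computable_total (fun p x => ifz (F p x) (G p x) (H p x)).
Proof.
  intros HF HG HH.
  assert (R : recursive2 (fun a b => ifz a (fst_nat b) (snd_nat b))) by recursive_tac.
  apply (computable_total_ext _
    (computable_total_comp2 R HF (computable_total_npair HG HH))).
  intros p x; now rewrite fst_npair, snd_npair.
Qed.

Lemma computable_total_sum_below F G :
  computable_total (fun p y => F p (fst_nat y) (snd_nat y)) -> computable_total G ->
  computable_total (fun p x => sum_below (F p x) (G p x)).
Proof.
  intros (phi & R1 & S1 & C1) (psi & R2 & S2 & C2).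
  (* The accumulator is 0 as soon as one summand is undecided, and the successor of the partial sum
     otherwise; hence the start value 1. *)
  set (s := fun c x n => primrec 1 (fun i z => ifz z 0
         (ifz (phi c (npair x i)) 0 (z + pred (phi c (npair x i))))) n).
  assert (Hs : forall p x k k' n, k <= k' -> s (code_prefix p k) x n <> 0 ->
            s (code_prefix p k') x n = s (code_prefix p k) x n).
  { intros p x k k' n Hk; induction n as [|n IH]; [reflexivity|].
    unfold s, primrec in *; simpl.
    set (u := nat_rect _ _ _ n) in *; set (u' := nat_rect _ _ _ n) in *.
    destruct u as [|u0]; [easy|]; rewrite IH by easy; simpl.
    destruct (phi (code_prefix p k) (npair x n)) as [|v] eqn:E; [easy|].
    now rewrite (stable_eq p _ S1 E Hk). }
  exists (fun c x => ifz (psi c x) 0 (s c x (pred (psi c x)))); split; [|split].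
  - unfold recursive2; cbv beta.
    apply recursive_ifz; [recursive_tac|recursive_tac|].
    unfold s; apply (@recursive_primrec (fun _ => 1) (fun y i z => ifz z 0
         (ifz (phi (fst_nat y) (npair (snd_nat y) i)) 0
            (z + pred (phi (fst_nat y) (npair (snd_nat y) i)))))); recursive_tac.
  - intros p x k k' Hk; destruct (psi (code_prefix p k) x) as [|v] eqn:E; [easy|].
    rewrite (stable_eq p x S2 E Hk); simpl; now apply Hs.
  - intros p x v ->.
    assert (Hc : forall n, exists k, s (code_prefix p k) x n = S (sum_below (F p x) n)).
    { induction n as [|n [k IH]]; [exists 0; reflexivity|].
      destruct (C1 p (npair x n) _ eq_refl) as [k' Hk'].
      rewrite fst_npair, snd_npair in Hk'.
      exists (max k k').
      assert (IH' : s (code_prefix p (max k k')) x n = S (sum_below (F p x) n)).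
      { rewrite (@Hs p x k); [easy|lia|rewrite IH; easy]. }
      apply (fun H => stable_eq p _ S1 H (Nat.le_max_r k k')) in Hk'.
      unfold s, primrec in *; simpl; rewrite IH'; simpl; rewrite Hk'; simpl.
      f_equal. }
    destruct (C2 p x _ eq_refl) as [k Hk]; destruct (Hc (G p x)) as [k' Hk'].
    exists (max k k').
    rewrite (stable_eq p x S2 Hk) by lia; simpl.
    rewrite (@Hs p x k'); [easy|lia|rewrite Hk'; easy].
Qed.

Lemma computable_rel_search F : computable_total F ->
  computable_rel (fun p x n => F p (npair x n) = 0 /\
    forall m, m < n -> F p (npair x m) <> 0).
Proof.
  intros (phi & R1 & S1 & C1).
  (* [pred] maps an undecided query and a found zero alike to 0, so the search stops at whichever
     comes first. The output below is withheld unless the stop was a genuine zero. *)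
  set (s := fun c x => first_zero (fun i => pred (phi c (npair x i))) (code_length c)).
  assert (Hs : forall p x k k', k <= k' ->
            phi (code_prefix p k) (npair x (s (code_prefix p k) x)) = 1 ->
            s (code_prefix p k') x = s (code_prefix p k) x).
  { intros p x k k' Hk H; unfold s at 1; apply first_zero_eq.
    - pose proof (first_zero_le (fun i => pred (phi (code_prefix p k) (npair x i)))
        (code_length (code_prefix p k))) as Hl.
      unfold s; rewrite !code_length_prefix in *; lia.
    - intros i Hi; apply first_zero_below in Hi.
      destruct (phi (code_prefix p k) (npair x i)) as [|v] eqn:E; [easy|].
      now rewrite (stable_eq p _ S1 E Hk).
    - now rewrite (stable_eq p _ S1 H Hk). }
  exists (fun c x => ifz (phi c (npair x (s c x))) 0
            (ifz (pred (phi c (npair x (s c x)))) (S (s c x)) 0)); split; [|split].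
  - assert (recursive2 s).
    { unfold s; unfold recursive2.
      apply (@recursive_first_zero (fun y i => pred (phi (fst_nat y) (npair (snd_nat y) i))));
        recursive_tac. }
    recursive_tac.
  - intros p x k k' Hk.
    destruct (phi (code_prefix p k) (npair x (s (code_prefix p k) x))) as [|[|v]] eqn:E;
      try easy.
    now rewrite (Hs p x k k'), (stable_eq p _ S1 E Hk).
  - intros p x n [H0 H].
    destruct (@converges_below phi p (fun i => npair x i) (fun i => F p (npair x i)) (S n) S1)
      as [K HK]; [intros; now apply C1|].
    exists (max K n).
    assert (Hsn : s (code_prefix p (max K n)) x = n).
    { unfold s; rewrite code_length_prefix; apply first_zero_eq; [lia| |].
      - intros i Hi; rewrite HK by lia; now apply H.
      - rewrite HK by lia; easy. }
    rewrite Hsn, HK, H0 by lia; reflexivity.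
Qed.

Lemma computable_rel_substitute Phi Psi : computable_rel Phi -> computable_rel Psi ->
  computable_rel (fun p x w => exists q, (forall i, Phi p (npair x i) (q i)) /\ Psi q x w).
Proof.
  intros (phi & R1 & S1 & C1) (psi & R2 & S2 & C2).
  (* The inner oracle is trusted up to its first undecided entry, at most up to the length of the
     prefix, and the outer computation runs on exactly that initial segment. *)
  set (s := fun c x => first_zero (fun i => phi c (npair x i)) (code_length c)).
  set (q_ := fun c x i => pred (phi c (npair x i))).
  exists (fun c x => psi (code_init (q_ c x) (s c x)) x).
  assert (Hc : forall c x, code_init (q_ c x) (s c x) = code_prefix (q_ c x) (s c x))
    by (intros; apply code_init_prefix).
  split; [|split].
  - assert (recursive2 (fun c x => code_init (q_ c x) (s c x))).
    { unfold recursive2.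
      apply (@recursive_code_init (fun y i => pred (phi (fst_nat y) (npair (snd_nat y) i)))
        (fun y => s (fst_nat y) (snd_nat y))).
      - recursive_tac.
      - apply (@recursive_first_zero (fun y i => phi (fst_nat y) (npair (snd_nat y) i)));
        recursive_tac. }
    recursive_tac.
  - intros p x k k' Hk; rewrite !Hc; intro H.
    set (c := code_prefix p k) in *; set (c' := code_prefix p k') in *.
    assert (E : code_prefix (q_ c x) (s c x) = code_prefix (q_ c' x) (s c x)).
    { unfold code_prefix at 1 2; f_equal; apply prefix_ext; intros i Hi.
      unfold q_; f_equal; symmetry; apply S1; [easy|].
      now apply (@first_zero_below (fun i => phi c (npair x i))) in Hi. }
    rewrite E in *; apply S2; [|easy].
    unfold s; apply first_zero_mono.
    + unfold c, c'; now rewrite !code_length_prefix.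
    + intros i Hi; unfold c, c' in *; now rewrite (S1 p _ k k').
  - intros p x w (q & Hq & Hw); apply C2 in Hw as [n Hn].
    destruct (@converges_below phi p (fun i => npair x i) q n S1) as [K HK];
      [intros; now apply C1|].
    exists (max K n); rewrite Hc.
    set (c := code_prefix p (max K n)) in *.
    assert (E : code_prefix (q_ c x) n = code_prefix q n).
    { unfold code_prefix at 1 2; f_equal; apply prefix_ext; intros i Hi.
      unfold q_, c; now rewrite HK by lia. }
    rewrite <- E in Hn; apply (stable_eq _ _ S2 Hn).
    unfold s, c; rewrite code_length_prefix; apply first_zero_ge; [lia|].
    intros i Hi; now rewrite HK by lia.
Qed.

Definition first_hit (h : nat -> nat) (p : Baire) (x v : nat) : Prop :=
  exists k, h (npair x (code_prefix p k)) = S v /\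
    forall k', k' < k -> h (npair x (code_prefix p k')) = 0.

(** An associate may change its answer after the first one. Replaying it on every initial segment of
    the prefix and keeping the first nonzero answer makes it stable. *)
Lemma computable_rel_first_hit h : recursive h -> computable_rel (first_hit h).
Proof.
  intro Hh.
  set (l := fun c x => primrec (h (npair x 0))
     (fun i z => ifz z (h (npair x (code_init (code_nth c) (S i)))) z)).
  assert (Hl : forall p x k n, n <= k -> l (code_prefix p k) x n =
     primrec (h (npair x 0)) (fun i z => ifz z (h (npair x (code_prefix p (S i)))) z) n).
  { intros p x k n; unfold l, primrec; induction n as [|n IH]; intro Hn; [reflexivity|].
    cbn [nat_rect]; rewrite IH by lia; now rewrite code_init_nth_prefix. }
  set (m := fun p x =>
     primrec (h (npair x 0)) (fun i z => ifz z (h (npair x (code_prefix p (S i)))) z)) in *.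
  exists (fun c x => l c x (code_length c)); split; [|split].
  - unfold recursive2, l.
    apply (@recursive_primrec (fun y => h (npair (snd_nat y) 0)) (fun y i z => ifz z
      (h (npair (snd_nat y) (code_init (code_nth (fst_nat y)) (S i)))) z)); try recursive_tac.
  - intros p x k k' Hk; rewrite !code_length_prefix, !Hl by easy.
    induction Hk as [|k' Hk IH]; intro H; [easy|].
    unfold m, primrec in *; cbn [nat_rect]; rewrite IH by easy.
    now destruct (nat_rect _ _ _ k).
  - intros p x v (k & Hk & Hk').
    exists k; rewrite code_length_prefix, Hl by easy.
    assert (H0 : forall n, n < k -> m p x n = 0).
    { induction n as [|n IH]; intro Hn.
      - now apply (Hk' 0).
      - unfold m, primrec in *; cbn [nat_rect]; rewrite IH by lia; simpl; now apply Hk'. }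
    destruct k as [|k]; [exact Hk|].
    specialize (H0 k); unfold m, primrec in *; cbn [nat_rect].
    rewrite H0 by lia; exact Hk.
Qed.

Lemma computable_rel_of_computable F : computable F ->
  computable_rel (fun p x v => exists q, F p = Some q /\ v = q x).
Proof.
  intros (h & Hh & H).
  apply (computable_rel_weaken _ (computable_rel_first_hit Hh)).
  intros p x v (q & Hq & ->); now apply (H p q).
Qed.

(** [F] is defined where [phi] decides every [n]. By stability the least deciding prefix already
    shows the final value, which is what an associate has to do; stability also makes the values
    unique, so they are those required by [Phi]. *)
Lemma computable_of_rel Phi : computable_rel Phi ->
  exists F, computable F /\ forall p q, (forall n, Phi p n (q n)) -> F p = Some q.
Proof.
  intros (phi & R & S1 & C).
  set (good := fun p q => forall n, converges phi p n (q n)).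
  exists (fun p => match excluded_middle_informative (exists q, good p q) with
                   | left H => Some (proj1_sig (constructive_indefinite_description _ H))
                   | right _ => None
                   end); split.
  - exists (fun y => phi (snd_nat y) (fst_nat y)); split; [recursive_tac|].
    intros p q; destruct (excluded_middle_informative _) as [H|]; [|easy].
    destruct (constructive_indefinite_description _ H) as [q' Hq]; simpl; intros [= ->] n.
    destruct (Hq n) as [k Hk].
    revert Hk; pattern k; apply (well_founded_ind lt_wf); clear k; intros k IH Hk.
    destruct (classic (exists k', k' < k /\ phi (code_prefix p k') n <> 0)) as [(k' & H1 & H2)|H1].
    + apply (IH k' H1); rewrite <- Hk; symmetry; apply S1; [lia|easy].
    + exists k; rewrite fst_npair, snd_npair; split; [easy|].
      intros k' Hk'; rewrite fst_npair, snd_npair.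
      apply NNPP; intro; apply H1; eauto.
  - intros p q Hq.
    destruct (excluded_middle_informative _) as [H|H].
    + destruct (constructive_indefinite_description _ H) as [q' Hq']; simpl; f_equal.
      apply functional_extensionality; intro n.
      destruct (Hq' n) as [k Hk], (C _ _ _ (Hq n)) as [k' Hk'].
      exact (stable_unique p n _ _ S1 Hk Hk').
    + exfalso; apply H; exists q; intro n; now apply C.
Qed.

Lemma computable_some F : computable_total F -> computable (fun p => Some (F p)).
Proof.
  intros HF.
  destruct (computable_of_rel HF) as (F' & [h [Hh H]] & HF').
  exists h; split; [easy|]; intros p q [= <-]; apply H, HF'; reflexivity.
Qed.

Ltac computable_step :=
  first [ assumption
        | match goal with
          | |- computable_total (fun _ x => @?f x) =>
              apply (@computable_total_recursive f); solve [recursive_tac]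
          end
        | match goal with
          | |- computable_total (fun p x => p _) => apply computable_total_query
          | |- computable_total (fun p x => ifz _ _ _) => apply computable_total_ifz
          | |- computable_total (fun p x => npair _ _) => apply computable_total_npair
          | |- computable_total (fun p x => sum_below _ _) => apply computable_total_sum_below
          | |- computable_total (fun p x => ?f (@?a p x)) =>
              apply (@computable_total_comp1 f a); [solve [recursive_tac]|]
          | |- computable_total (fun p x => ?f (@?a p x) (@?b p x)) =>
              apply (@computable_total_comp2 f a b); [solve [recursive_tac]| |]
          end ].
Ltac computable_tac := repeat (computable_step; cbv beta).

Lemma computable_total_bpair_oracle a b :
  computable_total a -> computable_total b ->
  computable_total (fun p x => bpair (a p) (b p) x).
Proof.
  intros Ha Hb.
  apply computable_total_ext with
    (fun p x => ifz (x mod 2) (a p (x / 2)) (b p (x / 2)));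
    [|intros; now rewrite bpair_mod].
  apply computable_total_ifz; [computable_tac| |].
  - apply (computable_total_comp Ha (G := fun _ x => x / 2)); computable_tac.
  - apply (computable_total_comp Hb (G := fun _ x => x / 2)); computable_tac.
Qed.

(** * Binary words, trees and measure *)

Fixpoint words (P : list bool -> bool) (m : nat) : list (list bool) :=
  match m with
  | 0 => if P [] then [[]] else []
  | S m' => map (cons false) (words (fun w => P (false :: w)) m')
            ++ map (cons true) (words (fun w => P (true :: w)) m')
  end.

Definition count (P : list bool -> bool) (m : nat) : nat := length (words P m).

Lemma count_S P m :
  count P (S m) = count (fun w => P (false :: w)) m + count (fun w => P (true :: w)) m.
Proof. unfold count; simpl; now rewrite length_app, !length_map. Qed.

Lemma in_words P m w : In w (words P m) <-> length w = m /\ P w = true.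
Proof.
  revert P w; induction m as [|m IH]; intros P w; simpl.
  - destruct (P []) eqn:E; simpl; split.
    + now intros [<-|[]].
    + destruct w; [auto|now intros []].
    + easy.
    + destruct w; [intros []; congruence|now intros []].
  - rewrite in_app_iff, !in_map_iff; split.
    + intros [(v & <- & Hv)|(v & <- & Hv)]; apply IH in Hv as [<- Hv]; auto.
    + destruct w as [|[|] w]; intros [H1 H2]; [easy|right|left]; exists w;
        (split; [easy|]); apply IH; injection H1; auto.
Qed.

Lemma count_le_pow2 P m : count P m <= 2 ^ m.
Proof.
  revert P; induction m as [|m IH]; intro P.
  - unfold count; simpl; destruct (P []); simpl; lia.
  - rewrite count_S; specialize (IH (fun w => P (false :: w))) as H1.
    specialize (IH (fun w => P (true :: w))); simpl; lia.
Qed.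

Lemma count_or P Q R m : (forall w, P w = true -> Q w = true \/ R w = true) ->
  count P m <= count Q m + count R m.
Proof.
  revert P Q R; induction m as [|m IH]; intros P Q R H.
  - unfold count; simpl; specialize (H []).
    destruct (P []), (Q []), (R []); simpl; try lia; now destruct H.
  - rewrite !count_S.
    pose proof (IH _ _ _ (fun w => H (false :: w))).
    pose proof (IH _ _ _ (fun w => H (true :: w))); cbv beta in *; lia.
Qed.

Lemma count_lt_witness P Q m : count Q m < count P m ->
  exists w, length w = m /\ P w = true /\ Q w = false.
Proof.
  intro H; apply NNPP; intro N.
  assert (count P m <= count Q m); [|lia].
  apply NoDup_incl_length.
  - clear; unfold words; revert P; induction m as [|m IH]; intro P.
    + simpl; destruct (P []); repeat constructor; auto.
    + apply NoDup_app.
      * apply FinFun.Injective_map_NoDup, IH; now intros ? ? [= ->].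
      * apply FinFun.Injective_map_NoDup, IH; now intros ? ? [= ->].
      * intros w [v [<- _]]%in_map_iff [v' [E _]]%in_map_iff; discriminate.
  - intros w [Hl Hw]%in_words; apply in_words; split; [easy|].
    destruct (Q w) eqn:E; [easy|]; exfalso; apply N; eauto.
Qed.

(** The words of length [m] correspond under [pos_of] to the numbers from [2^m] to [2^(m+1) - 1],
    with the first letter as lowest digit. Splitting words by their first letter is thus splitting
    the sum into even and odd indices. *)
Lemma count_sum_below m P g :
  (forall w, length w = m -> g (Pos.to_nat (pos_of w)) = b2n (P w)) ->
  sum_below (fun V => g (2 ^ m + V)) (2 ^ m) = count P m.
Proof.
  assert (Hd : forall f n, sum_below f (2 * n)
      = sum_below (fun V => f (2 * V)) n + sum_below (fun V => f (2 * V + 1)) n).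
  { intros f n; induction n as [|n IH]; [reflexivity|].
    replace (2 * S n) with (S (S (2 * n))) by lia.
    unfold sum_below, primrec in *; cbn [nat_rect]; rewrite IH.
    replace (2 * n + 1) with (S (2 * n)) by lia; lia. }
  assert (He : forall f f' n, (forall V, f V = f' V) -> sum_below f n = sum_below f' n).
  { intros f f' n H; unfold sum_below, primrec; induction n; simpl; auto. }
  revert P g; induction m as [|m IH]; intros P g H.
  - specialize (H [] eq_refl); unfold count; simpl in *; unfold sum_below, primrec; simpl.
    change (Pos.to_nat 1) with 1 in H; rewrite H; destruct (P []); reflexivity.
  - rewrite count_S.
    rewrite <- (IH (fun w => P (false :: w)) (fun n => g (2 * n))).
    + rewrite <- (IH (fun w => P (true :: w)) (fun n => g (2 * n + 1))).
      * change (2 ^ S m) with (2 * 2 ^ m) at 2; rewrite Hd; f_equal; apply He; intro V;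
          f_equal; simpl; lia.
      * intros w Hw; rewrite <- (H (true :: w)) by (simpl; lia); f_equal; simpl.
        rewrite Pos2Nat.inj_xI; lia.
    + intros w Hw; rewrite <- (H (false :: w)) by (simpl; lia); f_equal; simpl.
      rewrite Pos2Nat.inj_xO; lia.
Qed.

Definition extends (u w : list bool) : bool :=
  if list_eq_dec Bool.bool_dec (firstn (length u) w) u then true else false.

Lemma extends_spec u w : extends u w = true <-> firstn (length u) w = u.
Proof. unfold extends; destruct list_eq_dec; split; easy. Qed.

Lemma count_false P m : (forall w, P w = false) -> count P m = 0.
Proof.
  intro H; destruct (words P m) as [|w l] eqn:E; [unfold count; now rewrite E|].
  assert (Hw : In w (words P m)) by (rewrite E; now left).
  apply in_words in Hw; rewrite H in Hw; easy.
Qed.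

(** Multiplied out, because the truncated exponent of [2 ^ (m - length u)] would give too weak a
    bound when [u] is longer than [m]. *)
Lemma count_extends u m : count (extends u) m * 2 ^ length u <= 2 ^ m.
Proof.
  assert (He : forall P Q n, (forall w, P w = true -> Q w = true) -> count P n <= count Q n).
  { intros P Q n H; pose proof (@count_or P Q (fun _ => false) n) as H'.
    rewrite (@count_false (fun _ => false)) in H' by easy.
    rewrite Nat.add_0_r in H'; apply H'; auto. }
  revert m; induction u as [|b u IH]; intro m.
  - simpl; pose proof (count_le_pow2 (extends []) m); lia.
  - destruct m as [|m].
    + unfold count; simpl; destruct (extends (b :: u) []) eqn:E; simpl; [|lia].
      apply extends_spec in E; discriminate.
    + rewrite count_S.
      assert (count (fun w => extends (b :: u) (negb b :: w)) m = 0).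
      { apply count_false; intro w; destruct (extends (b :: u) _) eqn:E; [|easy].
        apply extends_spec in E; destruct b; discriminate. }
      assert (count (fun w => extends (b :: u) (b :: w)) m <= count (extends u) m).
      { apply He; intros w E; apply extends_spec in E; apply extends_spec.
        simpl in E; now injection E. }
      specialize (IH m); destruct b; simpl in *; nia.
Qed.

Lemma bprefix_S x n : bprefix x (S n) = bprefix x n ++ [x n].
Proof. unfold bprefix; now rewrite seq_S, map_app. Qed.

Lemma length_bprefix x n : length (bprefix x n) = n.
Proof. unfold bprefix; now rewrite length_map, length_seq. Qed.

Lemma bprefix_add x n m : bprefix x (n + m) = bprefix x n ++ bprefix (fun j => x (n + j)) m.
Proof.
  unfold bprefix; rewrite seq_app, map_app; f_equal; simpl.
  clear; revert n; induction m as [|m IH]; intro n; simpl; [easy|].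
  rewrite Nat.add_0_r, IH; f_equal; rewrite <- seq_shift, map_map.
  apply map_ext; intro; f_equal; lia.
Qed.

Lemma firstn_bprefix x n m : m <= n -> firstn m (bprefix x n) = bprefix x m.
Proof.
  intro H; replace n with (m + (n - m)) by lia.
  rewrite bprefix_add, firstn_app, length_bprefix, Nat.sub_diag.
  rewrite firstn_all2 by (rewrite length_bprefix; lia); now rewrite app_nil_r.
Qed.

Lemma skipn_bprefix x n m : skipn m (bprefix x n) = bprefix (fun j => x (m + j)) (n - m).
Proof.
  destruct (Nat.le_ge_cases m n) as [H|H].
  - replace n with (m + (n - m)) at 1 by lia.
    rewrite bprefix_add, skipn_app, length_bprefix, Nat.sub_diag.
    rewrite skipn_all2 by (rewrite length_bprefix; lia); easy.
  - replace (n - m) with 0 by lia; rewrite skipn_all2; [easy|rewrite length_bprefix; lia].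
Qed.

(** Call a word [big] if it has extensions of all lengths in the tree. Excluded middle lets the path
    turn to [false] whenever that keeps it big; otherwise [true] does. *)
Lemma konig (t : list bool -> bool) : is_tree t ->
  (forall m, exists w, length w = m /\ t w = true) ->
  exists x, forall n, t (bprefix x n) = true.
Proof.
  intros Ht Hinf.
  set (big := fun w => forall m, exists v, length v = m /\ t (w ++ v) = true).
  assert (Hstep : forall w, big w -> ~ big (w ++ [false]) -> big (w ++ [true])).
  { intros w Hw Hf m.
    apply not_all_ex_not in Hf as [m0 Hm0].
    (* An extension this long serves both cases: cut to [m0] letters it refutes a start with
       [false], cut to [m] letters it is the witness above [true]. *)
    destruct (Hw (S (m + m0))) as ([|b v] & Hv & Htv); [easy|].
    destruct b.
    - exists (firstn m v); rewrite length_firstn; simpl in Hv; split; [lia|].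
      apply Ht with (skipn m v); rewrite <- !app_assoc; simpl; now rewrite firstn_skipn.
    - exfalso; apply Hm0; exists (firstn m0 v).
      rewrite length_firstn; simpl in Hv; split; [lia|].
      apply Ht with (skipn m0 v); rewrite <- !app_assoc; simpl; now rewrite firstn_skipn. }
  set (next := fun w => if excluded_middle_informative (big (w ++ [false])) then false else true).
  set (W := nat_rect (fun _ => list bool) [] (fun _ w => w ++ [next w])).
  exists (fun n => next (W n)); intro n.
  assert (HW : bprefix (fun n => next (W n)) n = W n /\ big (W n)).
  { induction n as [|n [IH1 IH2]]; [split; [reflexivity|exact Hinf]|].
    rewrite bprefix_S, IH1; split; [reflexivity|].
    simpl; unfold next; destruct (excluded_middle_informative _); auto. }
  destruct HW as [-> Hb]; destruct (Hb 0) as ([|] & H0 & H); [|easy].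
  now rewrite app_nil_r in H.
Qed.

(** * Covers and the density of trees *)

Open Scope R_scope.

Definition hit (c : nat -> option (list bool)) (n : nat) (w : list bool) : bool :=
  existsb (fun i => match c i with Some u => extends u w | None => false end) (seq 0 n).

(** Union bound; a cylinder whose word is longer than [m] contains no word of this level and
    contributes nothing. *)
Lemma count_hit c n m : INR (count (hit c n) m) <= 2 ^ m * cover_psum c n.
Proof.
  induction n as [|n IH].
  - rewrite count_false by easy; simpl; lra.
  - set (P := fun w => match c n with Some u => extends u w | None => false end).
    assert (H : (count (hit c (S n)) m <= count (hit c n) m + count P m)%nat).
    { apply count_or; intro w; unfold hit; rewrite seq_S, existsb_app; simpl.
      intros [H|H]%Bool.orb_prop; [now left|right].
      now rewrite Bool.orb_false_r in H. }
    apply le_INR in H; rewrite plus_INR in H.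
    assert (HP : INR (count P m) <= 2 ^ m * cyl_weight (c n)); [|simpl; lra].
    unfold P; destruct (c n) as [u|]; [|rewrite count_false by easy; simpl; lra].
    pose proof (count_extends u m) as Hu; apply le_INR in Hu.
    rewrite mult_INR, !pow_INR in Hu; simpl in Hu.
    change (fun w => extends u w) with (extends u).
    replace (1 + 1) with 2 in Hu by lra.
    simpl; rewrite pow_inv; assert (0 < 2 ^ length u) by (apply pow_lt; lra).
    apply Rmult_le_reg_r with (2 ^ length u); [easy|].
    rewrite Rmult_assoc, Rinv_l by lra; lra.
Qed.

(* Otherwise the words avoiding every cylinder of the cover form an infinite tree. *)
Lemma cover_psum_ge_density (T : Tree) (a : nat) :
  (forall m, a * 2 ^ m <= S a * count (proj1_sig T) m)%nat ->
  forall c, covers c (paths T) -> exists N, INR a / INR (S a) <= cover_psum c N.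
Proof.
  destruct T as [t Ht]; cbn [proj1_sig]; intros Hd c Hc; apply NNPP; intro N.
  (* Level [n] avoids only the first [n] cylinders: the finite union bound then applies at every
     level, while an infinite path still avoids all of them. *)
  set (s := fun w => (t w && negb (hit c (length w) w))%bool).
  assert (Hhit : forall n n' u v, (n <= n')%nat -> hit c n u = true -> hit c n' (u ++ v) = true).
  { intros n n' u v Hn H; unfold hit in *; apply existsb_exists in H as (i & Hi & H).
    apply existsb_exists; exists i; rewrite in_seq in *; split; [lia|].
    destruct (c i) as [w|]; [|easy]; apply extends_spec in H; apply extends_spec.
    rewrite firstn_app; rewrite H at 1.
    assert (Hl : (length w <= length u)%nat).
    { rewrite <- H at 1; rewrite length_firstn; lia. }
    replace (length w - length u)%nat with 0%nat by lia; apply app_nil_r. }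
  destruct (@konig s) as [x Hx].
  - intros u v H; unfold s in *; apply andb_prop in H as [H1 H2].
    rewrite (Ht u v H1); simpl.
    destruct (hit c (length u) u) eqn:E; [|easy].
    rewrite (@Hhit (length u) (length (u ++ v)) u v) in H2; [easy| |easy].
    rewrite length_app; lia.
  - intro m.
    destruct (@count_lt_witness t (hit c m) m) as (w & Hl & H1 & H2).
    + apply INR_lt; apply Rle_lt_trans with (1 := count_hit c m m).
      assert (HN : cover_psum c m < INR a / INR (S a)).
      { apply Rnot_le_lt; intro; apply N; eauto. }
      specialize (Hd m); apply le_INR in Hd; rewrite !mult_INR, pow_INR in Hd.
      change (INR 2) with (1 + 1) in Hd; replace (1 + 1) with 2 in Hd by lra.
      assert (0 < INR (S a)) by (apply lt_0_INR; lia).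
      assert (0 < 2 ^ m) by (apply pow_lt; lra).
      apply Rlt_le_trans with (2 ^ m * (INR a / INR (S a))).
      * now apply Rmult_lt_compat_l.
      * apply Rmult_le_reg_l with (INR (S a)); [easy|].
        replace (INR (S a) * (2 ^ m * (INR a / INR (S a)))) with (INR a * 2 ^ m)
          by (field; lra); easy.
    + exists w; split; [easy|]; unfold s; now rewrite Hl, H1, H2.
  - assert (Hp : paths (exist _ t Ht) x).
    { intro n; specialize (Hx n); apply andb_prop in Hx; easy. }
    apply Hc in Hp as (i & w & Hi & Hw).
    (* At this level cylinder [i] is among those tested, and the prefix of [x] is long enough to
       contain [w]. *)
    specialize (Hx (S i + length w)%nat); apply andb_prop in Hx as [_ Hx].
    rewrite length_bprefix in Hx.
    apply Bool.negb_true_iff in Hx; rewrite <- Bool.not_true_iff_false in Hx; apply Hx.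
    unfold hit; apply existsb_exists; exists i; rewrite in_seq, Hi; split; [lia|].
    apply extends_spec; rewrite firstn_bprefix by lia; exact Hw.
Qed.

Definition total_weight (L : list (list bool)) : R :=
  fold_right (fun w s => (/ 2) ^ length w + s) 0 L.

Lemma total_weight_app L L' : total_weight (L ++ L') = total_weight L + total_weight L'.
Proof. induction L as [|w L IH]; simpl; [lra|]; rewrite IH; lra. Qed.

Lemma total_weight_nonneg L : 0 <= total_weight L.
Proof.
  induction L as [|w L IH]; simpl; [lra|].
  assert (0 < (/ 2) ^ length w) by (apply pow_lt; lra); lra.
Qed.

Lemma cover_psum_nth_error L N : cover_psum (nth_error L) N <= total_weight L.
Proof.
  assert (H : cover_psum (nth_error L) N = total_weight (firstn N L)).
  { induction N as [|N IH]; [easy|]; simpl cover_psum; rewrite IH.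
    destruct (nth_error L N) as [w|] eqn:E; simpl cyl_weight.
      destruct (nth_error_split L N E) as (L1 & L2 & -> & <-).
      rewrite firstn_app, Nat.sub_diag, firstn_all, app_nil_r.
      rewrite firstn_app; replace (S (length L1) - length L1)%nat with 1%nat by lia.
      rewrite firstn_all2 by lia; rewrite total_weight_app; simpl; lra.
    - apply nth_error_None in E; rewrite !firstn_all2 by lia; lra. }
  rewrite H; rewrite <- (firstn_skipn N L) at 2; rewrite total_weight_app.
  pose proof (total_weight_nonneg (skipn N L)); lra.
Qed.

Lemma is_tree_subtree t u : is_tree t -> is_tree (fun v => t (u ++ v)).
Proof. intros H v v' Hv; apply H with v'; now rewrite <- app_assoc. Qed.

Definition subtree (T : Tree) (u : list bool) : Tree :=
  exist _ (fun v => proj1_sig T (u ++ v)) (is_tree_subtree u (proj2_sig T)).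

(* If every cone had relative density below [a/(a+1)] at some level, refining the
   trivial cover [k] times would cover [paths T] with weight [(a/(a+1))^k]. *)
Lemma density_point (T : Tree) (a : nat) : measure_gt (paths T) 0 ->
  exists u, forall m, (a * 2 ^ m <= S a * count (proj1_sig (subtree T u)) m)%nat.
Proof.
  intros (d & Hd & HT); apply NNPP; intro N.
  set (r := INR a / INR (S a)).
  assert (HS : 0 < INR (S a)) by (apply lt_0_INR; lia).
  assert (Ha : 0 <= INR a) by apply pos_INR.
  assert (Hr : 0 <= r < 1).
  { unfold r; split.
    - apply Rmult_le_pos; [easy|]; left; now apply Rinv_0_lt_compat.
    - apply Rmult_lt_reg_r with (INR (S a)); [easy|].
      unfold Rdiv; rewrite Rmult_assoc, Rinv_l by lra; rewrite S_INR; lra. }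
  set (covered := fun L u => forall x, paths T x -> in_cyl u x -> exists w, In w L /\ in_cyl w x).
  assert (H1 : forall u, exists L, covered L u /\ total_weight L <= r * (/ 2) ^ length u).
  { intro u.
    apply not_ex_all_not with (n := u) in N; apply not_all_ex_not in N as [m Hm].
    exists (map (app u) (words (proj1_sig (subtree T u)) m)); split.
    - intros x Hx Hu; exists (bprefix x (length u + m)); split.
      + unfold in_cyl in Hu; rewrite bprefix_add, Hu; apply in_map.
        apply in_words; split; [apply length_bprefix|].
        simpl; rewrite <- Hu at 1; rewrite <- bprefix_add; apply Hx.
      + unfold in_cyl; now rewrite length_bprefix.
    - assert (HW : forall L, (forall w, In w L -> length w = m) ->
        total_weight (map (app u) L) = INR (length L) * (/ 2) ^ (length u + m)).
      { induction L as [|w L IH]; intro HL; [simpl; lra|].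
        cbn [map total_weight fold_right length]; fold (total_weight (map (app u) L)).
        rewrite IH by (intros; apply HL; now right).
        rewrite S_INR, length_app, (HL w) by (now left); ring. }
      rewrite HW by (intros w Hw; now apply in_words in Hw).
      fold (count (proj1_sig (subtree T u)) m); set (k := count _ m) in *.
      assert (Hk : (S a * k <= a * 2 ^ m)%nat) by lia.
      apply le_INR in Hk; rewrite !mult_INR, pow_INR in Hk.
      change (INR 2) with (1 + 1) in Hk; replace (1 + 1) with 2 in Hk by lra.
      rewrite pow_add, (pow_inv 2 m).
      assert (0 < 2 ^ m) by (apply pow_lt; lra).
      assert (0 < (/ 2) ^ length u) by (apply pow_lt; lra).
      assert (INR k * / 2 ^ m <= r).
      { apply Rmult_le_reg_r with (2 ^ m * INR (S a)).
        - now apply Rmult_lt_0_compat.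
        - unfold r; replace (INR k * / 2 ^ m * (2 ^ m * INR (S a))) with (INR (S a) * INR k)
            by (field; lra).
          replace (INR a / INR (S a) * (2 ^ m * INR (S a))) with (INR a * 2 ^ m)
            by (field; lra); easy. }
      nra. }
  assert (H2 : forall L, exists L', (forall u, In u L -> covered L' u) /\
                total_weight L' <= r * total_weight L).
  { induction L as [|u L (L' & IH1 & IH2)].
    - exists []; split; [easy|simpl; lra].
    - destruct (H1 u) as (Lu & Hu1 & Hu2); exists (Lu ++ L'); split.
      + intros u' [<-|Hu'] x Hx Hux.
        * destruct (Hu1 x Hx Hux) as (w & ? & ?); exists w; rewrite in_app_iff; auto.
        * destruct (IH1 _ Hu' x Hx Hux) as (w & ? & ?); exists w; rewrite in_app_iff; auto.
      + rewrite total_weight_app; simpl; lra. }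
  assert (H3 : forall k, exists L, (forall x, paths T x -> exists w, In w L /\ in_cyl w x) /\
                total_weight L <= r ^ k).
  { induction k as [|k (L & IH1 & IH2)].
    - exists [[]]; split; [|simpl; lra].
      intros x _; exists []; split; [now left|reflexivity].
    - destruct (H2 L) as (L' & HL1 & HL2); exists L'; split.
      + intros x Hx; destruct (IH1 x Hx) as (u & Hu & Hux); now apply (HL1 u Hu).
      + simpl; apply Rle_trans with (1 := HL2); apply Rmult_le_compat_l; lra. }
  destruct (pow_lt_1_zero r) with (y := d) as [k Hk]; [rewrite Rabs_pos_eq; lra|lra|].
  specialize (Hk k (Nat.le_refl k)).
  destruct (H3 k) as (L & HL1 & HL2).
  destruct (HT (nth_error L)) as [M HM].
  - intros x Hx; destruct (HL1 x Hx) as (w & Hw & Hwx).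
    apply In_nth_error in Hw as [i Hi]; eauto.
  - pose proof (cover_psum_nth_error L M); pose proof (Rle_abs (r ^ k)); lra.
Qed.

Lemma measure_gt_inhabited A e : 0 <= e -> measure_gt A e -> exists x, A x.
Proof.
  intros He (d & Hd & H); apply NNPP; intro N.
  destruct (H (fun _ => None)) as [M HM].
  - intros x Hx; exfalso; eauto.
  - assert (H0 : cover_psum (fun _ => None) M = 0) by (induction M; simpl in *; lra).
    lra.
Qed.

(** * Attaching a stem to paths and trees *)

Definition prepend (u : list bool) (x : nat -> bool) (j : nat) : bool :=
  if (j <? length u)%nat then nth j u false else x (j - length u)%nat.

Lemma prepend_add u x j : prepend u x (length u + j) = x j.
Proof.
  unfold prepend; destruct (Nat.ltb_spec (length u + j) (length u)); [lia|f_equal; lia].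
Qed.

Lemma bprefix_prepend u x m : bprefix (prepend u x) (length u + m) = u ++ bprefix x m.
Proof.
  rewrite bprefix_add; f_equal.
  - apply nth_ext with (d := false) (d' := false); rewrite length_bprefix; [easy|].
    intros n Hn; unfold bprefix.
    rewrite nth_indep with (d' := prepend u x 0) by (now rewrite length_map, length_seq).
    rewrite map_nth, seq_nth by easy; unfold prepend; simpl.
    destruct (Nat.ltb_spec n (length u)); [easy|lia].
  - unfold bprefix; apply map_ext; intro; apply prepend_add.
Qed.

(** The prefix of length [n] is first enlarged by [length u] letters, so that it contains all of
    [u]; prefix closure of [T] brings it back. *)
Lemma paths_prepend T u x : paths (subtree T u) x -> paths T (prepend u x).
Proof.
  intros H n; apply (proj2_sig T) with (bprefix (fun j => prepend u x (n + j)) (length u)).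
  rewrite <- bprefix_add, Nat.add_comm, bprefix_prepend; apply (H n).
Qed.

(** Words shorter than [u] are all kept, so that membership in the tree
    depends on the bits of [u] only through a comparison of full length. *)
Definition graft_fun (u : list bool) (t : list bool -> bool) (w : list bool) : bool :=
  if (length w <? length u)%nat then true
  else (extends u w && t (skipn (length u) w))%bool.

Lemma is_tree_graft_fun u t : is_tree t -> is_tree (graft_fun u t).
Proof.
  intros Ht v v'; unfold graft_fun; rewrite length_app.
  destruct (Nat.ltb_spec (length v) (length u)) as [H|H]; [easy|].
  destruct (Nat.ltb_spec (length v + length v') (length u)) as [H'|H']; [lia|].
  intros [H1 H2]%andb_prop; apply extends_spec in H1.
  rewrite firstn_app, skipn_app in *.
  replace (length u - length v)%nat with 0%nat in * by lia.
  rewrite app_nil_r in H1; simpl in H2.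
  rewrite (proj2 (extends_spec u v) H1); simpl; now apply Ht in H2.
Qed.

Definition graft (u : list bool) (T : Tree) : Tree :=
  exist _ (graft_fun u (proj1_sig T)) (is_tree_graft_fun u (proj2_sig T)).

Lemma paths_graft u T x :
  paths (graft u T) x <-> bprefix x (length u) = u /\ paths T (fun j => x (length u + j)%nat).
Proof.
  unfold paths; simpl; unfold graft_fun; split.
  - intro H; split.
    + specialize (H (length u)); rewrite length_bprefix, Nat.ltb_irrefl in H.
      apply andb_prop in H as [H _]; apply extends_spec in H.
      now rewrite firstn_bprefix in H.
    + intro n; specialize (H (length u + n)%nat); rewrite length_bprefix in H.
      destruct (Nat.ltb_spec (length u + n) (length u)); [lia|].
      apply andb_prop in H as [_ H]; rewrite skipn_bprefix in H.
      now replace (length u + n - length u)%nat with n in H by lia.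
  - intros [H1 H2] n; rewrite length_bprefix.
    destruct (Nat.ltb_spec n (length u)) as [H|H]; [easy|].
    rewrite skipn_bprefix, H2, Bool.andb_true_r; apply extends_spec.
    now rewrite firstn_bprefix.
Qed.

(** Deleting the first [k] letters of every word turns a cover of the graft into a cover of [T] and
    multiplies each weight by at most [2^k]. This includes words shorter than [k], which become
    empty. *)
Lemma measure_gt_graft u T : measure_gt (paths T) 0 -> measure_gt (paths (graft u T)) 0.
Proof.
  intros (d & Hd & HT); set (k := length u).
  assert (H2 : 0 < 2 ^ k) by (apply pow_lt; lra).
  exists (/ 2 ^ k * d); split.
  - apply Rmult_lt_0_compat; [now apply Rinv_0_lt_compat|easy].
  - intros c Hc; set (c' := fun i => option_map (skipn k) (c i)).
    destruct (HT c') as [N HN].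
    + intros x Hx.
      destruct (Hc (prepend u x)) as (i & w & Hi & Hw).
      { apply paths_graft; split.
        - pose proof (bprefix_prepend u x 0) as H.
          now rewrite Nat.add_0_r, app_nil_r in H.
        - replace (fun j => prepend u x (length u + j)) with x; [easy|].
          apply functional_extensionality; intro; now rewrite prepend_add. }
      exists i, (skipn k w); unfold c'; rewrite Hi; split; [easy|].
      unfold in_cyl in *; rewrite length_skipn.
      rewrite <- Hw at 2; rewrite skipn_bprefix; f_equal.
      apply functional_extensionality; intro; unfold k; now rewrite prepend_add.
    + exists N; apply Rmult_le_reg_l with (2 ^ k); [easy|].
      rewrite <- Rmult_assoc, Rinv_r, Rmult_1_l by lra.
      apply Rle_trans with (1 := HN); clear HN.
      induction N as [|N IH]; [simpl; lra|]; simpl cover_psum.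
      assert (cyl_weight (c' N) <= 2 ^ k * cyl_weight (c N)); [|lra].
      unfold c'; destruct (c N) as [w|]; simpl; [|lra].
      rewrite length_skipn, !pow_inv.
      assert (0 < 2 ^ length w) by (apply pow_lt; lra).
      assert (0 < 2 ^ (length w - k)) by (apply pow_lt; lra).
      apply Rmult_le_reg_r with (2 ^ length w * 2 ^ (length w - k));
        [now apply Rmult_lt_0_compat|].
      replace (/ 2 ^ (length w - k) * (2 ^ length w * 2 ^ (length w - k)))
        with (2 ^ length w) by (field; lra).
      replace (2 ^ k * / 2 ^ length w * (2 ^ length w * 2 ^ (length w - k)))
        with (2 ^ (k + (length w - k))) by (rewrite pow_add; field; lra).
      apply Rle_pow; [lra|lia].
Qed.

Close Scope R_scope.

(** * Arithmetic of word codes *)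

(** Little-endian like [pos_of], so that a prefix of a word is a remainder of its number and the
    rest of the word is the quotient. *)
Fixpoint bits_value (u : list bool) : nat :=
  match u with [] => 0 | b :: u' => b2n b + 2 * bits_value u' end.

Fixpoint bits (l U : nat) : list bool :=
  match l with 0 => [] | S l' => Nat.odd U :: bits l' (U / 2) end.

Lemma bits_value_lt u : bits_value u < 2 ^ length u.
Proof. induction u as [|[|] u IH]; simpl; lia. Qed.

Lemma bits_value_inj u v : length u = length v -> bits_value u = bits_value v -> u = v.
Proof.
  revert v; induction u as [|b u IH]; intros [|b' v] Hl Hv; try easy.
  simpl in *; assert (b = b') by (destruct b, b'; simpl in *; lia); subst.
  f_equal; apply IH; lia.
Qed.

Lemma pos_of_app u v :
  Pos.to_nat (pos_of (u ++ v)) = bits_value u + 2 ^ length u * Pos.to_nat (pos_of v).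
Proof.
  induction u as [|[|] u IH]; simpl.
  - lia.
  - rewrite Pos2Nat.inj_xI, IH; lia.
  - rewrite Pos2Nat.inj_xO, IH; lia.
Qed.

Lemma pos_of_bounds w :
  2 ^ length w <= Pos.to_nat (pos_of w) < 2 ^ S (length w).
Proof.
  pose proof (pos_of_app w []) as H; rewrite app_nil_r in H.
  change (Pos.to_nat (pos_of [])) with 1 in H.
  pose proof (bits_value_lt w); simpl; lia.
Qed.

Lemma S_wcode w : S (wcode w) = Pos.to_nat (pos_of w).
Proof. unfold wcode; pose proof (Pos2Nat.is_pos (pos_of w)); lia. Qed.

Lemma b2n_odd n : b2n (Nat.odd n) = n mod 2.
Proof.
  rewrite <- Nat.bit0_mod, Nat.bit0_odd; now destruct (Nat.odd n).
Qed.

Lemma length_bits l U : length (bits l U) = l.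
Proof. revert U; induction l; simpl; auto. Qed.

Lemma bits_value_bits l U : bits_value (bits l U) = U mod 2 ^ l.
Proof.
  revert U; induction l as [|l IH]; intro U; [symmetry; apply Nat.mod_1_r|].
  cbn [bits bits_value]; rewrite IH, b2n_odd, Nat.pow_succ_r'.
  now rewrite Nat.Div0.mod_mul_r.
Qed.

Lemma bits_bits_value u : bits (length u) (bits_value u) = u.
Proof.
  apply bits_value_inj; [apply length_bits|].
  rewrite bits_value_bits; apply Nat.mod_small, bits_value_lt.
Qed.

Lemma nth_bits l U j : j < l -> b2n (nth j (bits l U) false) = (U / 2 ^ j) mod 2.
Proof.
  revert U j; induction l as [|l IH]; intros U j H; [lia|].
  destruct j as [|j]; cbn [bits nth].
  - now rewrite Nat.pow_0_r, Nat.div_1_r, b2n_odd.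
  - rewrite IH by lia; now rewrite Nat.pow_succ_r', Nat.Div0.div_div.
Qed.

(** Puts [bits l U] in front of the word with code [c]; [S c] and the final [- 1] pass between
    [wcode] and the positive number behind it. *)
Definition append_code (l U c : nat) : nat := U mod 2 ^ l + 2 ^ l * S c - 1.

Lemma wcode_bits_app l U v : wcode (bits l U ++ v) = append_code l U (wcode v).
Proof.
  unfold append_code; rewrite S_wcode, <- bits_value_bits.
  pose proof (pos_of_app (bits l U) v) as H; rewrite length_bits in H; rewrite <- H.
  unfold wcode; lia.
Qed.

(* The value of the tree [graft (1^n 0) T] at the word coded by [j], where [v] is
   the value of [T] at the word left after removing the first [n + 1] letters. *)
Definition graft_value (n j v : nat) : nat :=
  ifz (2 ^ S n - S j)
    (ifz ((S j mod 2 ^ S n - (2 ^ n - 1)) + ((2 ^ n - 1) - S j mod 2 ^ S n)) v 0)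
    1.

(** For a word of at most [n] letters the quotient is 0 and truncation gives the query 0, the code
    of the empty word; [graft_value] ignores the answer. *)
Definition graft_rest (n j : nat) : nat := S j / 2 ^ S n - 1.

Definition unary (n : nat) : list bool := repeat true n ++ [false].

Lemma length_unary n : length (unary n) = S n.
Proof. unfold unary; rewrite length_app, repeat_length; simpl; lia. Qed.

Lemma bits_value_unary n : bits_value (unary n) = 2 ^ n - 1.
Proof.
  induction n as [|n IH]; [reflexivity|]; unfold unary in *; simpl; rewrite IH.
  pose proof (pow2_nonzero n); lia.
Qed.

Lemma graft_value_spec n t T w : tree_names t T ->
  graft_value n (wcode w) (t (graft_rest n (wcode w)))
  = b2n (proj1_sig (graft (unary n) T) w).
Proof.
  intro HT; unfold graft_value, graft_rest; rewrite S_wcode.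
  cbn [proj1_sig graft]; unfold graft_fun; rewrite length_unary.
  pose proof (pos_of_bounds w) as Hw.
  destruct (Nat.ltb_spec (length w) (S n)) as [H|H].
  - assert (2 ^ S (length w) <= 2 ^ S n) by (apply Nat.pow_le_mono_r; lia).
    destruct (2 ^ S n - Pos.to_nat (pos_of w)) eqn:E; [lia|reflexivity].
  - assert (2 ^ S n <= 2 ^ length w) by (apply Nat.pow_le_mono_r; lia).
    replace (2 ^ S n - Pos.to_nat (pos_of w)) with 0 by lia; cbn [ifz].
    pose proof (pos_of_app (firstn (S n) w) (skipn (S n) w)) as Hs.
    rewrite firstn_skipn in Hs.
    pose proof (bits_value_lt (firstn (S n) w)) as Hlt.
    rewrite (firstn_length_le w H) in Hs, Hlt.
    assert (Hm : Pos.to_nat (pos_of w) mod 2 ^ S n = bits_value (firstn (S n) w)).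
    { symmetry; apply Nat.mod_unique with (Pos.to_nat (pos_of (skipn (S n) w))); [easy|].
      rewrite Hs; lia. }
    assert (Hq : Pos.to_nat (pos_of w) / 2 ^ S n = Pos.to_nat (pos_of (skipn (S n) w))).
    { symmetry; apply Nat.div_unique with (bits_value (firstn (S n) w)); [easy|].
      rewrite Hs; lia. }
    rewrite Hm, Hq, <- S_wcode.
    replace (S (wcode (skipn (S n) w)) - 1) with (wcode (skipn (S n) w)) by lia.
    rewrite (HT (skipn (S n) w)), <- bits_value_unary.
    destruct (extends (unary n) w) eqn:E.
    + apply extends_spec in E; rewrite length_unary in E; rewrite E, Nat.sub_diag; reflexivity.
    + destruct (_ - _ + _) eqn:E'; [|reflexivity].
      assert (E'' : extends (unary n) w = true); [|congruence].
      apply extends_spec; rewrite length_unary; apply bits_value_inj; [|lia].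
      rewrite length_unary; now apply firstn_length_le.
Qed.

(** * Weihrauch reductions *)

(* A realizer of [g] can be altered at a single name, so in [Wred f g] each answer to
   the query [K p] can be considered separately. *)
Definition reduction (f g : Problem) (H K : Baire -> option Baire) : Prop :=
  forall p x, names (pin f) p x -> (exists y, prel f x y) ->
  exists a x', K p = Some a /\ names (pin g) a x' /\ (exists y', prel g x' y') /\
    forall s y', names (pout g) s y' -> prel g x' y' ->
    exists q, H (bpair p s) = Some q /\ exists y, names (pout f) q y /\ prel f x y.

Lemma Wred_reduction f g : Wred f g <->
  exists H K, computable H /\ computable K /\ reduction f g H K.
Proof.
  split; intros (H & K & HH & HK & HG); exists H, K; do 2 (split; [easy|]).
  - intros p x Hp Hx.
    set (solves := fun a s => exists x' y',
          names (pin g) a x' /\ prel g x' y' /\ names (pout g) s y').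
    (* [G0] picks solutions and is undefined where there are none, so its being defined at [K p]
       certifies that [K p] names a solvable instance of [g]. *)
    set (G0 := fun a => match excluded_middle_informative (exists s, solves a s) with
                 | left E => Some (proj1_sig (constructive_indefinite_description _ E))
                 | right _ => None
                 end).
    assert (HG0 : forall a s, G0 a = Some s -> solves a s).
    { intros a s; unfold G0; destruct (excluded_middle_informative _) as [E|]; [|easy].
      destruct (constructive_indefinite_description _ E); now intros [= <-]. }
    assert (RG0 : realizes g G0).
    { intros a x' Ha (y' & Hy').
      destruct (names_surj (pout g) y') as [s Hs].
      destruct (G0 a) as [s'|] eqn:E.
      - exists s'; split; [easy|].
        destruct (HG0 _ _ E) as (x'' & y'' & ? & ? & ?).
        rewrite (names_fun (pin g) a x' x''); eauto.
      - exfalso; unfold G0 in E.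
        destruct (excluded_middle_informative _) as [|N]; [easy|].
        apply N; exists s, x', y'; auto. }
    destruct (HG G0 RG0 p x Hp Hx) as (q & Hq & _).
    unfold wcompose in Hq; destruct (K p) as [a|] eqn:EK; [|easy].
    destruct (G0 a) as [s0|] eqn:E0; [|easy].
    destruct (HG0 _ _ E0) as (x' & y0 & Ha & Hy0 & _).
    exists a, x'; do 2 (split; [easy|]); split; [eauto|].
    intros s y' Hs Hy'.
    set (G1 := fun a' => if excluded_middle_informative (a' = a) then Some s else G0 a').
    destruct (HG G1) with (p := p) (x := x) as (q' & Hq' & Hy); auto.
    + intros a' x'' Ha' Hx''; unfold G1.
      destruct (excluded_middle_informative (a' = a)) as [->|]; [|now apply RG0].
      rewrite (names_fun (pin g) a x'' x') by easy; eauto.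
    + unfold wcompose in Hq'; rewrite EK in Hq'; unfold G1 in Hq'.
      destruct (excluded_middle_informative (a = a)) as [_|]; [eauto|easy].
  - intros G RG p x Hp Hx.
    destruct (HG p x Hp Hx) as (a & x' & Ka & Ha & Hx' & HH').
    destruct (RG a x' Ha Hx') as (s & Gs & y' & Hs & Hy').
    destruct (HH' s y' Hs Hy') as (q & Hq & Hy).
    exists q; unfold wcompose; now rewrite Ka, Gs.
Qed.

Lemma Wred_of_total f g H K :
  computable_total H -> computable_total K ->
  reduction f g (fun p => Some (H p)) (fun p => Some (K p)) -> Wred f g.
Proof.
  intros HH HK HR; apply Wred_reduction.
  exists (fun p => Some (H p)), (fun p => Some (K p)); auto using computable_some.
Qed.

(** * Compositions are reducible to [WWKL^Delta] *)

Lemma sum_below_eq0 f n : sum_below f n = 0 <-> forall i, i < n -> f i = 0.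
Proof.
  unfold sum_below, primrec; induction n as [|n IH]; simpl; [split; [lia|easy]|].
  split.
  - intros H i Hi; destruct (Nat.eq_dec i n) as [->|]; [lia|]; apply IH; lia.
  - intro H; rewrite (proj2 IH), (H n) by (intros; try apply H; lia); lia.
Qed.

Definition eq_nat (a b : nat) : nat := ifz ((a - b) + (b - a)) 1 0.

Lemma eq_nat_spec a b : eq_nat a b <> 0 <-> a = b.
Proof.
  unfold eq_nat, ifz; split.
  - destruct ((a - b) + (b - a)) eqn:E; [lia|easy].
  - intros ->; now rewrite Nat.sub_diag.
Qed.

(** One successor in [S (S n)] marks a decided value of [phi], the other is the convention by which
    an enumeration lists [n] as [S n]. *)
Definition enumerated (phi : nat -> nat -> nat) (c n : nat) : nat :=
  sum_below (fun i => eq_nat (phi c i) (S (S n))) (code_length c).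

Definition least_guess (phi : nat -> nat -> nat) (c : nat) : nat :=
  first_zero (enumerated phi c) (code_length c).

Lemma recursive_least_guess phi f :
  recursive2 phi -> recursive f -> recursive (fun x => least_guess phi (f x)).
Proof.
  intros Hphi Hf; unfold least_guess.
  apply recursive_first_zero; [|recursive_tac].
  unfold recursive2, enumerated.
  apply (@recursive_sum_below (fun y i => eq_nat (phi (f (fst_nat y)) i) (S (S (snd_nat y)))));
    unfold eq_nat; recursive_tac.
Qed.

(** Every number below the minimum of [A] is listed at some stage, and the minimum itself never
    is. *)
Lemma least_guess_limit phi p a (A : nat -> Prop) :
  stable phi -> (forall i, converges phi p i (a i)) ->
  (forall n, A n <-> ~ exists i, a i = S n) -> (exists n, A n) ->
  exists n N, A n /\ forall k, N <= k -> least_guess phi (code_prefix p k) = n.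
Proof.
  intros Hs Hc HA [n0 Hn0].
  assert (Hleast : exists n, A n /\ forall m, m < n -> ~ A m).
  { revert Hn0; pattern n0; apply (well_founded_ind lt_wf); clear n0; intros n IH Hn.
    destruct (classic (exists m, m < n /\ A m)) as [(m & Hm & Am)|N]; [eauto|].
    exists n; split; [easy|]; intros m Hm Am; eauto. }
  destruct Hleast as (n & An & Hmin).
  assert (Hin : forall k m, enumerated phi (code_prefix p k) m <> 0 <->
           exists i, i < k /\ phi (code_prefix p k) i = S (S m)).
  { intros k m; unfold enumerated; rewrite sum_below_eq0, code_length_prefix; split.
    - intro H; apply not_all_ex_not in H as [i H]; exists i.
      apply imply_to_and in H as [Hi H]; split; [easy|]; now apply eq_nat_spec.
    - intros (i & Hi & H) H'; now apply (proj2 (eq_nat_spec _ _) H), H'. }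
  assert (Hev : forall b, b <= n -> exists N, forall k m, N <= k -> m < b ->
           enumerated phi (code_prefix p k) m <> 0).
  { induction b as [|b IH]; intro Hb; [exists 0; lia|].
    destruct IH as [N HN]; [lia|].
    assert (Hnb : exists i, a i = S b).
    { apply NNPP; intro E; apply (Hmin b); [lia|]; now apply HA. }
    destruct Hnb as [i Hi]; destruct (Hc i) as [k Hk].
    exists (N + k + S i); intros k' m Hk' Hm.
    destruct (Nat.eq_dec m b) as [->|]; [|apply HN; lia].
    apply Hin; exists i; split; [lia|].
    rewrite <- Hi; apply (stable_eq p i Hs Hk); lia. }
  destruct (Hev n (Nat.le_refl n)) as [N HN].
  (* The prefix must also have length at least [n], as this length bounds the search in
     [least_guess]. *)
  exists n, (N + n); split; [easy|]; intros k Hk.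
  unfold least_guess; apply first_zero_eq.
  - rewrite code_length_prefix; lia.
  - intros i Hi; apply HN; lia.
  - destruct (enumerated phi (code_prefix p k) n) eqn:E; [easy|].
    assert (H : enumerated phi (code_prefix p k) n <> 0) by lia.
    apply Hin in H as (i & _ & Hi); destruct (Hc i) as [k' Hk'].
    exfalso; apply (proj1 (HA n) An); exists i.
    exact (stable_unique p i _ _ Hs Hk' Hi).
Qed.

Lemma computable_rel_reindex Phi f : computable_rel Phi -> recursive f ->
  computable_rel (fun p x v => Phi p (f x) v).
Proof.
  intros HP Hf.
  apply (computable_rel_weaken _
    (computable_rel_comp (computable_total_recursive Hf) HP)); eauto.
Qed.

(** The oracle handed to [F] may depend on the index, because the index also carries the guess. *)
Lemma computable_rel_run F B f : computable F ->
  computable_total (fun p y => B p (fst_nat y) (snd_nat y)) -> recursive f ->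
  computable_rel (fun p x v => exists q, F (B p x) = Some q /\ v = q (f x)).
Proof.
  intros HF HB Hf.
  apply (computable_rel_weaken _ (computable_rel_substitute HB
    (computable_rel_reindex (computable_rel_of_computable HF) Hf))).
  intros p x v H; exists (B p x); split; [|exact H].
  intro i; now rewrite fst_npair, snd_npair.
Qed.

(* Search for a stage at least [i] at which the computation relative to the current
   guess has stopped: early rows may be wrong, but they never get stuck, and from
   the stage on where the guess is final all rows agree. *)
Definition graft_stage (phi psi : nat -> nat -> nat) (y : nat) : nat :=
  let i := fst_nat (fst_nat y) in
  let j := snd_nat (fst_nat y) in
  let c := snd_nat y in
  let n := least_guess phi c in
  let t := psi c (npair n (graft_rest n j)) in
  ifz (i - code_length c) (ifz t 0 (S (graft_value n j (pred t)))) 0.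

Lemma recursive_graft_stage phi psi : recursive2 phi -> recursive2 psi ->
  recursive (graft_stage phi psi).
Proof.
  intros Hphi Hpsi; unfold graft_stage; cbv zeta.
  pose proof (recursive_least_guess Hphi (recursive_snd recursive_id)) as Hg.
  set (g := fun x => least_guess phi (snd_nat x)) in Hg.
  change (recursive (fun y => ifz (fst_nat (fst_nat y) - code_length (snd_nat y))
    (ifz (psi (snd_nat y) (npair (g y) (graft_rest (g y) (snd_nat (fst_nat y))))) 0
       (S (graft_value (g y) (snd_nat (fst_nat y))
          (pred (psi (snd_nat y) (npair (g y) (graft_rest (g y) (snd_nat (fst_nat y)))))))))
    0)).
  unfold graft_value, graft_rest; recursive_tac.
Qed.

Lemma first_hit_exists h p x k : h (npair x (code_prefix p k)) <> 0 ->
  exists v, first_hit h p x v.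
Proof.
  pattern k; apply (well_founded_ind lt_wf); clear k; intros k IH Hk.
  destruct (classic (exists k', k' < k /\ h (npair x (code_prefix p k')) <> 0))
    as [(k' & Hk' & H)|N]; [eauto|].
  exists (pred (h (npair x (code_prefix p k)))), k; split; [lia|].
  intros k' Hk'; apply NNPP; eauto.
Qed.

Lemma graft_stage_limit phi psi p n t T N :
  (forall k, N <= k -> least_guess phi (code_prefix p k) = n) -> stable psi ->
  (forall j, converges psi p (npair n j) (t j)) -> tree_names t T ->
  exists r r', (forall x, first_hit (graft_stage phi psi) p x (r x)) /\
    limDelta_names r r' /\ tree_names r' (graft (unary n) T).
Proof.
  intros HN Hs Ht HT.
  set (h := graft_stage phi psi).
  assert (Hh : forall i j k, N <= k -> h (npair (npair i j) (code_prefix p k)) <> 0 ->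
    h (npair (npair i j) (code_prefix p k)) = S (graft_value n j (t (graft_rest n j)))).
  { intros i j k Hk; unfold h, graft_stage; cbv zeta.
    rewrite !fst_npair, !snd_npair, HN, code_length_prefix by easy.
    destruct (i - k); [|easy]; simpl ifz.
    destruct (psi _ _) as [|v] eqn:E; [easy|]; intros _; simpl ifz.
    destruct (Ht (graft_rest n j)) as [k' Hk'].
    now rewrite (stable_unique p _ _ _ Hs Hk' E). }
  assert (Hr : forall x, exists v, first_hit h p x v).
  { intro x; destruct (Ht (graft_rest n (snd_nat x))) as [k Hk].
    (* This stage lies past [N], past the convergence of the needed entry of [t] and past the row
       number. *)
    apply first_hit_exists with (N + k + fst_nat x).
    unfold h, graft_stage; cbv zeta.
    rewrite !fst_npair, !snd_npair, HN, code_length_prefix by lia.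
    replace (fst_nat x - (N + k + fst_nat x)) with 0 by lia; simpl ifz.
    rewrite (stable_eq p _ Hs Hk) by lia; easy. }
  apply functional_choice in Hr as [r Hr].
  exists r, (fun j => graft_value n j (t (graft_rest n j))); split; [easy|]; split.
  (* Entries of row [i] wait for stage [i], so from row [N] on only the final guess is used. *)
  - exists N; intros i j Hi.
    destruct (Hr (npair i j)) as (k & Hk & _).
    assert (Hik : i <= k).
    { unfold h, graft_stage in Hk; cbv zeta in Hk.
      rewrite !snd_npair, !fst_npair, code_length_prefix in Hk.
      destruct (i - k) eqn:E; [lia|easy]. }
    pose proof Hk as Hk'; rewrite Hh in Hk'; [|lia|lia]; now injection Hk'.
  - intro w; now apply graft_value_spec.
Qed.

Lemma paths_graft_unary n T x : paths (graft (unary n) T) x ->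
  (forall j, j < n -> x j = true) /\ x n = false /\ paths T (fun j => x (S n + j)).
Proof.
  intro H; apply paths_graft in H as [H1 H2]; rewrite length_unary in *.
  assert (Hx : forall j, j <= n -> x j = nth j (unary n) false).
  { intros j Hj; rewrite <- H1; unfold bprefix.
    rewrite nth_indep with (d' := x 0) by (rewrite length_map, length_seq; lia).
    rewrite map_nth, seq_nth by lia; reflexivity. }
  unfold unary in Hx; split; [|split; [|exact H2]].
  - intros j Hj; rewrite Hx by lia.
    rewrite app_nth1 by (rewrite repeat_length; lia).
    now apply nth_repeat_lt.
  - rewrite Hx, app_nth2 by (rewrite ?repeat_length; lia).
    now rewrite repeat_length, Nat.sub_diag.
Qed.

(* The postprocessing reads [n] off the path [1^n 0 z], recomputes the name [q] of
   the intermediate result and applies [Hf] to [q] and [z]. *)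
Lemma computable_postprocess Hg Hf : computable Hg -> computable Hf ->
  exists H, computable H /\ forall p s n q r,
    (forall j, j < n -> s j <> 0) -> s n = 0 ->
    Hg (bpair p (fun _ => n)) = Some q ->
    Hf (bpair q (fun j => s (S n + j))) = Some r -> H (bpair p s) = Some r.
Proof.
  intros CHg CHf.
  (* The index [u] has the form [<<x, n>, i>]: the output position, the number found by the search,
     and the queried position in the input of [Hf]. *)
  set (B := fun (y : Baire) (u : nat) =>
              bpair (fun j => y (2 * j)) (fun _ => snd_nat (fst_nat u))).
  assert (HB : computable_total (fun y v => B y (fst_nat v) (snd_nat v))).
  { unfold B; apply computable_total_ext with (fun y v =>
      ifz (snd_nat v mod 2) (y (2 * (snd_nat v / 2))) (snd_nat (fst_nat (fst_nat v))));
      [computable_tac|intros; now rewrite bpair_mod]. }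
  assert (H1 := @computable_rel_run Hg B (fun u => snd_nat u / 2) CHg HB
    ltac:(recursive_tac)).
  (* Even positions return the entry of [q] just computed; odd positions read [s] behind the stem of
     length [n + 1]. *)
  assert (H2 : computable_total (fun y w =>
     ifz (snd_nat (fst_nat w) mod 2) (snd_nat w)
       (y (2 * (S (snd_nat (fst_nat (fst_nat w))) + snd_nat (fst_nat w) / 2) + 1))))
    by computable_tac.
  assert (H3 := computable_rel_bind H1 H2).
  assert (H4 := computable_rel_substitute H3
    (computable_rel_reindex (computable_rel_of_computable CHf) (recursive_fst recursive_id))).
  assert (H5 : computable_total (fun y x => y (2 * snd_nat x + 1))) by computable_tac.
  assert (H6 := computable_rel_bind (computable_rel_search H5) H4).
  apply computable_of_rel in H6 as (H & CH & HH).
  exists H; split; [easy|]; intros p s n q r Hs Hn Hq Hr; apply HH; intro x.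
  exists n; split.
  - rewrite snd_npair, bpair_odd; split; [easy|].
    intros m Hm; rewrite snd_npair, bpair_odd; auto.
  - exists (bpair q (fun j => s (S n + j))); split.
    + intro i; exists (q (i / 2)).
      rewrite !fst_npair, !snd_npair, ?fst_npair, bpair_odd, bpair_mod; split; [|easy].
      exists q; split; [|easy].
      unfold B; rewrite fst_npair, snd_npair.
      replace (fun j => bpair p s (2 * j)) with p; [easy|].
      apply functional_extensionality; intro; now rewrite bpair_even.
    + exists r; split; [easy|]; now rewrite fst_npair.
Qed.

Lemma compose_Wred_jump_WWKL e (X Y Z : RepSpace)
    (f0 : Y -> Z -> Prop) (g0 : X -> Y -> Prop) :
  (0 <= e)%R ->
  Wred {| pin := Y; pout := Z; prel := f0 |} (epsWWKL e) ->
  Wred {| pin := X; pout := Y; prel := g0 |} CN ->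
  Wred (compose X Y Z f0 g0) (jump WWKL).
Proof.
  intros He Hf Hg.
  apply Wred_reduction in Hf as (Hf & Kf & CHf & CKf & Rf).
  apply Wred_reduction in Hg as (Hg & Kg & CHg & CKg & Rg).
  destruct (computable_rel_of_computable CKg) as (phi & Rphi & Sphi & Cphi).
  (* This is the tree that [epsWWKL] would receive if [CN] answered [fst_nat y]. For a wrong answer
     it need not exist, hence a relation. *)
  assert (Htau : computable_rel (fun p y v => exists q t,
     Hg (bpair p (fun _ => fst_nat y)) = Some q /\ Kf q = Some t /\ v = t (snd_nat y))).
  { set (B := fun (p : Baire) (u : nat) => bpair p (fun _ => fst_nat (fst_nat u))).
    assert (HB : computable_total (fun y v => B y (fst_nat v) (snd_nat v))).
    { apply computable_total_ext with (fun y v =>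
        ifz (snd_nat v mod 2) (y (snd_nat v / 2)) (fst_nat (fst_nat (fst_nat v))));
        [computable_tac|intros; unfold B; now rewrite bpair_mod]. }
    assert (H1 := @computable_rel_run Hg B snd_nat CHg HB (recursive_snd recursive_id)).
    apply (computable_rel_weaken _ (computable_rel_substitute H1
      (computable_rel_reindex (computable_rel_of_computable CKf) (recursive_snd recursive_id)))).
    intros p y v (q & t & Hq & Ht & ->); exists q; split; [|eauto].
    intro i; exists q; unfold B; now rewrite snd_npair, fst_npair. }
  destruct Htau as (psi & Rpsi & Spsi & Cpsi).
  destruct (computable_of_rel (computable_rel_first_hit (recursive_graft_stage Rphi Rpsi)))
    as (K & CK & HK).
  destruct (computable_postprocess CHg CHf) as (H & CH & HH).
  apply Wred_reduction; exists H, K; do 2 (split; [easy|]).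
  intros p x Hp (z0 & Hx & Hdom & _); simpl in x, Hp.
  destruct (Rg p x Hp Hx) as (a & A & Ka & Ha & HA & Hsol); simpl in A, Ha, HA, Hsol.
  destruct (@least_guess_limit phi p a A) as (n & N & An & HN); auto.
  { intro i; apply Cphi; eauto. }
  (* The answer [n] is named by the constant sequence here, in [Htau] and in the postprocessing, so
     all three compute the same [q]. *)
  destruct (Hsol (fun _ => n) n eq_refl An) as (q & Hq & y & Hqy & Hy).
  simpl in y, Hqy, Hy.
  (* A composition is defined at [x] only if all of [g0(x)] lies in the domain of [f0]; this makes
     [y] a legal instance. *)
  destruct (Rf q y Hqy (Hdom y Hy)) as (t & T & Kt & HtT & (x0 & HT & Hx0) & Hpost).
  simpl in T, HtT, x0, HT, Hx0, Hpost.
  destruct (@graft_stage_limit phi psi p n t T N) as (r & r' & Hr & Hlim & Hr'); auto.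
  { intro j; apply Cpsi; rewrite fst_npair, snd_npair; eauto. }
  assert (HT' : measure_gt (paths (graft (unary n) T)) 0).
  { apply measure_gt_graft; destruct HT as (d & Hd & HT); exists d; split; [lra|easy]. }
  exists r, (graft (unary n) T); split; [auto|]; split; [exists r'; auto|]; split.
  - destruct (measure_gt_inhabited (Rle_refl 0) HT') as [x1 Hx1]; exists x1; split; auto.
  - intros s x1 Hs [_ Hx1]; simpl in x1, Hs.
    apply paths_graft_unary in Hx1 as (H1 & H2 & H3).
    destruct (Hpost (fun j => s (S n + j)) (fun j => x1 (S n + j)))
      as (w & Hw & z & Hz & Hyz); [intro j; apply Hs|split; easy|].
    exists w; split.
    + apply (HH p s n q); auto.
      * intros j Hj; rewrite Hs, H1 by easy; easy.
      * rewrite Hs, H2; easy.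
    + exists z; split; [easy|]; repeat split; eauto.
Qed.

(** * [WWKL^Delta] is reducible to a composition *)

Lemma baire_surj : forall x : Baire, exists p : Baire, p = x.
Proof. eauto. Qed.

Definition BaireSpace : RepSpace := {|
  carrier := Baire;
  names := fun p x => p = x;
  names_fun := fun p x y Hx Hy => eq_trans (eq_sym Hx) Hy;
  names_surj := baire_surj
|}.

(* A guess [n] codes [<N, <l, U>>]: row [N] is the limit tree and the cone above
   [bits l U] has density at least [a/(a+1)] at every level. *)
Definition row (n : nat) : nat := fst_nat n.
Definition stem_length (n : nat) : nat := fst_nat (snd_nat n).
Definition stem_bits (n : nat) : nat := snd_nat (snd_nat n).
Definition stem (n : nat) : list bool := bits (stem_length n) (stem_bits n).
Definition cone_index (n c : nat) : nat :=
  npair (row n) (append_code (stem_length n) (stem_bits n) c).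

(** A sum of truncated differences vanishes only if each does: the first two express that the rows
    agree at [j], the last the density bound at level [m]. [2 ^ m + V - 1] runs through the codes of
    the words of length [m]. *)
Definition refutation (a : nat) (r : Baire) (y : nat) : nat :=
  let n := fst_nat y in
  let i := fst_nat (snd_nat y) in
  let j := fst_nat (snd_nat (snd_nat y)) in
  let m := snd_nat (snd_nat (snd_nat y)) in
  (r (npair (row n + i) j) - r (npair (row n) j))
  + (r (npair (row n) j) - r (npair (row n + i) j))
  + (a * 2 ^ m - S a * sum_below (fun V => r (cone_index n (2 ^ m + V - 1))) (2 ^ m)).

Definition good_guess (a : nat) (r : Baire) (n : nat) : Prop :=
  forall s, refutation a r (npair n s) = 0.

Lemma good_guess_spec a r n : good_guess a r n <->
  (forall i j, r (npair (row n + i) j) = r (npair (row n) j)) /\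
  forall m, a * 2 ^ m <= S a * sum_below (fun V => r (cone_index n (2 ^ m + V - 1))) (2 ^ m).
Proof.
  unfold good_guess, refutation; cbv zeta; split.
  - intro H; split.
    + intros i j; specialize (H (npair i (npair j 0))).
      rewrite !snd_npair, !fst_npair in H; lia.
    + intro m; specialize (H (npair 0 (npair 0 m))).
      rewrite !snd_npair, !fst_npair in H; lia.
  - intros [H1 H2] s; rewrite !fst_npair, !snd_npair, H1.
    specialize (H2 (snd_nat (snd_nat s))); lia.
Qed.

(** [r] is returned along with the guess, because in a composition the second problem sees nothing
    but the output of the first. *)
Definition good_guess_rel (a : nat) (r y : Baire) : Prop :=
  exists n, good_guess a r n /\ y = bpair r (fun _ => n).

(** Meant for [y = bpair r (fun _ => n)], where [y 1] is the guess and the even positions hold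
    [r]. *)
Definition cone_name (y : Baire) (c : nat) : nat := y (2 * cone_index (y 1) c).

Definition cone_path_rel (e : R) (y z : Baire) : Prop :=
  exists T, tree_names (cone_name y) T /\ measure_gt (paths T) e /\
  exists x, paths T x /\ z = fun j => b2n (prepend (stem (y 1)) x j).

(** Being good is a universal statement over decidable tests, so the failed tests enumerate the
    complement of the good guesses. *)
Lemma good_guess_rel_Wred_CN a :
  Wred {| pin := BaireSpace; pout := BaireSpace; prel := good_guess_rel a |} CN.
Proof.
  apply Wred_of_total with
    (H := fun y => bpair (fun j => y (2 * j)) (fun _ => y 1))
    (K := fun r y => ifz (refutation a r y) 0 (S (fst_nat y))).
  - apply computable_total_bpair_oracle; computable_tac.
  - unfold refutation, cone_index, append_code, row, stem_length, stem_bits; computable_tac.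
  - intros p x E (y & n & Hn & Hy); simpl in E; subst x.
    exists (fun y => ifz (refutation a p y) 0 (S (fst_nat y))), (good_guess a p).
    split; [easy|]; split; [|split; [exists n; easy|]].
    + intro m; unfold good_guess; split.
      * intros H [i Hi].
        destruct (refutation a p i) as [|k] eqn:E; [easy|]; injection Hi as <-.
        specialize (H (snd_nat i)); rewrite npair_eta in H; congruence.
      * intros H s; destruct (refutation a p (npair m s)) as [|k] eqn:E; [easy|].
        exfalso; apply H; exists (npair m s); rewrite E; simpl; now rewrite fst_npair.
    + intros s m Hs Hm; simpl in s, m, Hs, Hm.
      eexists; split; [reflexivity|]; eexists; split; [reflexivity|].
      exists m; split; [easy|].
      replace (fun j => bpair p s (2 * j)) with p
        by (apply functional_extensionality; intro; now rewrite bpair_even).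
      change 1 with (2 * 0 + 1); now rewrite bpair_odd, Hs.
Qed.

Lemma cone_path_rel_Wred_epsWWKL e :
  Wred {| pin := BaireSpace; pout := BaireSpace; prel := cone_path_rel e |} (epsWWKL e).
Proof.
  (* [H] receives the instance paired with the path, so the guess, at position 1 of the instance, is
     found at position 2. The output is the stem followed by the path. *)
  apply Wred_of_total with (K := cone_name)
    (H := fun y j => ifz (stem_length (y 2) - j)
             (y (2 * (j - stem_length (y 2)) + 1))
             ((stem_bits (y 2) / 2 ^ j) mod 2)).
  - apply computable_total_ifz.
    + apply (@computable_total_comp2 (fun n j => stem_length n - j) (fun y _ => y 2)
        (fun _ j => j)); [unfold stem_length; recursive_tac|computable_tac|computable_tac].
    + apply computable_total_query.
      apply (@computable_total_comp2 (fun n j => 2 * (j - stem_length n) + 1) (fun y _ => y 2)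
        (fun _ j => j)); [unfold stem_length; recursive_tac|computable_tac|computable_tac].
    + apply (@computable_total_comp2 (fun n j => (stem_bits n / 2 ^ j) mod 2) (fun y _ => y 2)
        (fun _ j => j)); [unfold stem_bits; recursive_tac|computable_tac|computable_tac].
  - unfold cone_name; apply computable_total_query.
    apply (@computable_total_comp2 (fun n c => 2 * cone_index n c) (fun y _ => y 1)
        (fun _ j => j)); [|computable_tac|computable_tac].
    unfold cone_index, append_code, row, stem_length, stem_bits; recursive_tac.
  - intros y x E (z & T & HT & Hm & x0 & Hx0 & _); simpl in E; subst x.
    exists (cone_name y), T; do 2 (split; [easy|]); split; [exists x0; split; easy|].
    intros s x1 Hs [_ Hx1]; simpl in x1, Hs.
    eexists; split; [reflexivity|]; eexists; split; [reflexivity|].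
    exists T; do 2 (split; [easy|]); exists x1; split; [easy|].
    apply functional_extensionality; intro j.
    change (bpair y s 2) with (bpair y s (2 * 1)); rewrite bpair_even, bpair_odd, Hs.
    unfold prepend, stem; rewrite length_bits.
    destruct (Nat.ltb_spec j (stem_length (y 1))) as [H|H].
    + rewrite nth_bits by easy.
      destruct (stem_length (y 1) - j) eqn:E; [lia|reflexivity].
    + now replace (stem_length (y 1) - j) with 0 by lia.
Qed.

Lemma cone_name_spec r q N l U T :
  (forall j, r (npair N j) = q j) -> tree_names q T ->
  tree_names (fun c => r (cone_index (npair N (npair l U)) c)) (subtree T (bits l U)).
Proof.
  intros Hr HT w; unfold cone_index, row, stem_length, stem_bits.
  rewrite !snd_npair, !fst_npair, Hr, <- wcode_bits_app; apply HT.
Qed.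

Lemma sum_below_cone r n T m :
  tree_names (fun c => r (cone_index n c)) T ->
  sum_below (fun V => r (cone_index n (2 ^ m + V - 1))) (2 ^ m) = count (proj1_sig T) m.
Proof.
  intro HT.
  rewrite <- (@count_sum_below m (proj1_sig T) (fun P => r (cone_index n (P - 1)))).
  - reflexivity.
  - intros w _; rewrite <- S_wcode; simpl; rewrite Nat.sub_0_r; apply HT.
Qed.

(** Since [a/(a+1) = 1 - 1/(a+1)], it suffices that [1/(a+1) < 1 - e]. *)
Lemma exists_density e : (e < 1)%R -> exists a, (e < INR a / INR (S a))%R.
Proof.
  intro He; destruct (archimed_cor1 (1 - e)) as (a & Ha & Ha0); [lra|].
  exists (pred a); rewrite Nat.succ_pred_pos by easy.
  assert (0 < INR a)%R by now apply lt_0_INR.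
  destruct a as [|a]; [lia|]; simpl pred.
  apply Rlt_le_trans with (1 - / INR (S a))%R; [lra|].
  rewrite S_INR in *; right; field; lra.
Qed.

Lemma jump_WWKL_Wred_compose e a : (0 <= e < INR a / INR (S a))%R ->
  Wred (jump WWKL) (compose BaireSpace BaireSpace BaireSpace (cone_path_rel e) (good_guess_rel a)).
Proof.
  intros [He0 He].
  apply Wred_of_total with (H := fun y j => y (2 * j + 1)) (K := fun p => p);
    [computable_tac|apply computable_rel_query|].
  intros r T (q & (N & HN) & HT) (x & Hmu & Hx); simpl in T, HT, Hmu, x, Hx.
  (* [CN] may answer with any good guess, not only with one built from the stage [N], so all of them
     must lead to a legal instance. *)
  assert (Hgood : forall n, good_guess a r n ->
    tree_names (cone_name (bpair r (fun _ => n))) (subtree T (stem n)) /\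
    measure_gt (paths (subtree T (stem n))) e).
  { intros n Hn; apply good_guess_spec in Hn as [Hn1 Hn2].
    assert (Hq : forall j, r (npair (row n) j) = q j).
    (* Row [row n + N] is past [N], hence equal to the limit, and goodness equates it with row
       [row n]. *)
    { intro j; rewrite <- (Hn1 N j); apply HN; lia. }
    pose proof (@cone_name_spec r q _ (stem_length n) (stem_bits n) T Hq HT) as Hc.
    unfold stem_length at 1, stem_bits at 1, row in Hc; rewrite !npair_eta in Hc.
    fold (stem n) in Hc; split.
    - intro w; rewrite <- (Hc w); unfold cone_name.
      change (bpair r (fun _ => n) 1) with n; apply bpair_even.
    - exists (INR a / INR (S a))%R; split; [easy|].
      apply cover_psum_ge_density; intro m.
      rewrite <- (sum_below_cone r n m Hc); apply Hn2. }
  assert (Hf0 : forall n, good_guess a r n -> exists z, cone_path_rel e (bpair r (fun _ => n)) z).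
  { intros n Hn; destruct (Hgood n Hn) as [H1 H2].
    destruct (measure_gt_inhabited He0 H2) as [x' Hx'].
    eexists; exists (subtree T (stem n)); do 2 (split; [easy|]); exists x'; split; easy. }
  assert (Hex : exists n, good_guess a r n).
  { destruct (@density_point T a Hmu) as [u Hu].
    exists (npair N (npair (length u) (bits_value u))).
    assert (Hc := @cone_name_spec r q N (length u) (bits_value u) T
      (fun j => HN N j (Nat.le_refl N)) HT).
    rewrite bits_bits_value in Hc.
    apply good_guess_spec; split.
    - intros i j; unfold row; rewrite fst_npair, !HN by lia; easy.
    - intro m; rewrite (sum_below_cone _ _ m Hc); apply Hu. }
  exists r, r; do 2 (split; [easy|]); split.
  - destruct Hex as [n Hn]; destruct (Hf0 n Hn) as [z Hz].
    exists z; split; [|split].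
    + exists (bpair r (fun _ => n)), n; easy.
    + intros y (n' & Hn' & ->); auto.
    + exists (bpair r (fun _ => n)); split; [exists n|]; easy.
  - intros s z E (_ & _ & y & (n & Hn & ->) & T' & HT' & _ & x' & Hx' & Hz).
    simpl in s, E; subst s; eexists; split; [reflexivity|].
    destruct (Hgood n Hn) as [Hc _].
    rewrite (tree_fun HT' Hc) in Hx'.
    change (bpair r (fun _ => n) 1) with n in Hz.
    exists (prepend (stem n) x'); split; [|split; [easy|now apply paths_prepend]].
    intro j; rewrite bpair_odd, Hz; reflexivity.
Qed.

Open Scope R_scope.

(* For all eps in [0,1): WWKL^Delta ≡W eps-WWKL * C_N *)
Theorem theorem11p4 (e : R) :
  0 <= e < 1 -> IsCompProd (jump WWKL) (epsWWKL e) CN.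
Proof.
  intros [He0 He1]; destruct (exists_density He1) as [a Ha]; split.
  - exists BaireSpace, BaireSpace, BaireSpace, (cone_path_rel e), (good_guess_rel a).
    pose proof (cone_path_rel_Wred_epsWWKL e) as Hf; pose proof (good_guess_rel_Wred_CN a) as Hg.
    do 2 (split; [easy|]); split.
    + now apply jump_WWKL_Wred_compose.
    + exact (compose_Wred_jump_WWKL He0 Hf Hg).
  - intros X Y Z f g; now apply compose_Wred_jump_WWKL.
Qed.
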